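(* Let $n\ge1$. (1) The unweighted dilation maximal operator $M_{\mathrm{Leb}}$ is not bounded on $L^p(G_n)$ for any $1\le p<\infty$, that is, for no such $p$ is there a constant $C$ with $\|M_{\mathrm{Leb}}f\|_{L^p(G_n)}\le C\|f\|_{L^p(G_n)}$ for all $f\in L^p(G_n)$; and it is not of weak type $(1,1)$, that is, there is no constant $C$ with $\mu\{M_{\mathrm{Leb}}f>\lambda\}\le\frac C\lambda\|f\|_{L^1(G_n)}$ for all $f\in L^1(G_n)$ and $\lambda>0$. (2) The Haar-compatible dilation maximal operator $\mathcal M_{\mathrm{dil}}$ is of weak type $(1,1)$, that is, there is a constant $C$ with $\mu\{\mathcal M_{\mathrm{dil}}f>\lambda\}\le\frac C\lambda\|f\|_{L^1(G_n)}$ for all $f\in L^1(G_n)$ and $\lambda>0$; and for every $1<p\le\infty$ it is bounded on $L^p(G_n)$, that is, there is a constant $C$ with $\|\mathcal M_{\mathrm{dil}}f\|_{L^p(G_n)}\le C\|f\|_{L^p(G_n)}$ for all $f\in L^p(G_n)$. (3) However, $\mathcal M_{\mathrm{dil}}$ is not bounded from $L^1(G_n)$ to $L^1(G_n)$.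
   Context: $G_n=\mathbb R^n\rtimes\mathbb R_+$ is the set $\mathbb R^n\times(0,\infty)$ with group law $(x,y)(x',y')=(x+yx',yy')$, equipped with the left Haar measure $d\mu(x,y)=\frac{dx\,dy}{y^{n+1}}$; $L^p(G_n)$ is taken with respect to $\mu$. For a locally integrable function $f$ on $G_n$, $$M_{\mathrm{Leb}}f(x,y)=\sup_{r>0}\frac1r\int_0^r|f(x,ye^t)|\,dt,$$ $$\mathcal M_{\mathrm{dil}}f(x,y)=\sup_{r>0}\frac1{V_n(r)}\int_0^r|f(x,ye^t)|e^{-nt}\,dt,\qquad V_n(r)=\int_0^re^{-nt}\,dt .$$ *)

(* Defs.v *)
From HB Require Import structures.
From mathcomp Require Import all_boot all_order all_algebra.
From mathcomp Require Import unstable all_classical all_reals all_analysis.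
From mathcomp Require Import measurable_realfun.

Set Implicit Arguments.
Unset Strict Implicit.
Unset Printing Implicit Defensive.
Import Order.TTheory GRing.Theory Num.Theory.
Import numFieldNormedType.Exports.

Local Open Scope classical_set_scope.
Local Open Scope ring_scope.

Notation Rn R n := (n.-tuple (measurableTypeR R)).

(* Lebesgue measure on R^n, by recursion on n: R^n.+1 is identified with
   R * R^n.  lebesgue_Rn_box below gives its value on boxes. *)
Section lebesgue_Rn.
Context {R : realType}.

Definition cons_pair n (p : measurableTypeR R * Rn R n) : Rn R n.+1 :=
  [the n.+1.-tuple (measurableTypeR R) of p.1 :: p.2].

Lemma measurable_cons_pair n : measurable_fun [set: _] (@cons_pair n).
Proof. exact: measurable_cons. Qed.

Section lebesgue_cons.
Variables (n : nat) (m : {sigma_finite_measure set (Rn R n) -> \bar R}).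

Definition lebesgue_cons : set (Rn R n.+1) -> \bar R :=
  pushforward (lebesgue_measure \x m)%E (@cons_pair n).

Let mcons := @measurable_cons_pair n.

Let lebesgue_cons0 : lebesgue_cons set0 = 0%E.
Proof. by rewrite /lebesgue_cons /pushforward preimage_set0 measure0. Qed.

Let lebesgue_cons_ge0 A : (0 <= lebesgue_cons A)%E.
Proof. exact: measure_ge0. Qed.

Let lebesgue_cons_sigma_additive : semi_sigma_additive lebesgue_cons.
Proof.
exact: (@measure_semi_sigma_additive _ _ _
  (measure_function_pushforward__canonical__measure_function_Measure _ mcons)).
Qed.

HB.instance Definition _ := isMeasure.Build _ _ _ lebesgue_cons
  lebesgue_cons0 lebesgue_cons_ge0 lebesgue_cons_sigma_additive.

Let lebesgue_cons_sigma_finite : sigma_finite setT lebesgue_cons.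
Proof.
have /sigma_finiteP[F [TF ndF Foo]] := sigma_finiteT (@lebesgue_measure R).
have /sigma_finiteP[G [TG ndG Goo]] := sigma_finiteT m.
pose hd (v : Rn R n.+1) : measurableTypeR R := tnth v ord0.
pose tl (v : Rn R n.+1) : Rn R n := [tuple of behead v].
exists (fun k => (hd @^-1` F k) `&` (tl @^-1` G k)) => [|k].
  apply/esym; rewrite -subTset => v _.
  have [i _ Fi] : (\bigcup_i F i) (hd v) by rewrite -TF.
  have [j _ Gj] : (\bigcup_i G i) (tl v) by rewrite -TG.
  exists (maxn i j) => //; split.
  - by have /subsetPset := ndF _ _ (leq_maxl i j); exact.
  - by have /subsetPset := ndG _ _ (leq_maxr i j); exact.
have [mF Foo'] := Foo k; have [mG Goo'] := Goo k.
split.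
  apply: measurableI; rewrite -[X in measurable X]setTI.
    exact: measurable_tnth.
  exact: measurable_behead.
rewrite /lebesgue_cons /pushforward [X in (_ \x _)%E X](_ : _ = F k `*` G k).
  by rewrite product_measure1E// lte_mul_pinfty// ge0_fin_numE.
have tlE x (v : Rn R n) : tl (cons_pair (x, v)) = v by exact/val_inj.
by apply/seteqP; split => -[x v]; rewrite /preimage/= tlE.
Qed.

HB.instance Definition _ := Measure_isSigmaFinite.Build _ _ _ lebesgue_cons
  lebesgue_cons_sigma_finite.

End lebesgue_cons.

Fixpoint lebesgue_Rn n : {sigma_finite_measure set (Rn R n) -> \bar R} :=
  match n with
  | 0 => \d_([tuple] : Rn R 0)
  | n'.+1 => lebesgue_cons (lebesgue_Rn n')
  end.

Lemma lebesgue_Rn_box n (A : 'I_n -> set (measurableTypeR R)) :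
  (forall i, measurable (A i)) ->
  lebesgue_Rn n [set v : Rn R n | forall i, A i (tnth v i)] =
  (\prod_(i < n) lebesgue_measure (A i))%E.
Proof.
elim: n A => [|n IHn] A mA.
  by rewrite big_ord0 /= diracE mem_set//= => -[].
pose B : set (Rn R n) := [set v | forall i, A (lift ord0 i) (tnth v i)].
have mB : measurable B.
  rewrite (_ : B = \bigcap_(i in [set: 'I_n])
      ((fun v : Rn R n => tnth v i) @^-1` A (lift ord0 i))).
    apply: fin_bigcap_measurable => [|i _]; first exact: finite_finset.
    rewrite -[X in measurable X]setTI; exact: measurable_tnth.
  by apply/seteqP; split => v Bv i; [move=> _; exact: Bv|exact: (Bv i I)].
rewrite big_ord_recl -IHn//= -[RHS]product_measure1E//.
rewrite /lebesgue_cons /pushforward; congr product_measure1.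
apply/seteqP; split => -[x v] /=.
  move=> Av; split; first exact: (Av ord0).
  by move=> i; have := Av (lift ord0 i); rewrite tnthS.
move=> [Ax Bv] i; case: (unliftP ord0 i) => [j|] ->; last exact: Ax.
by rewrite tnthS; exact: Bv.
Qed.

End lebesgue_Rn.

(* The carrier (0, oo) of R_+, with its Borel sigma-algebra. *)
Section haar.
Context (R : realType).

Definition posreal := {posnum R}.
HB.instance Definition _ := Choice.on posreal.
HB.instance Definition _ := isPointed.Build posreal 1%:pos.

Definition Rpos := g_sigma_algebra_preimageType
  (fun y : posreal => (y%:num : measurableTypeR R)).

Definition Rpos_val (y : Rpos) : measurableTypeR R := y%:num.

Lemma Rpos_val_gt0 (y : Rpos) : 0 < Rpos_val y :> R.
Proof. exact: (@gt0 R _ (y : {posnum R})). Qed.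

Let measurable_image (B : set Rpos) :
  measurable B -> measurable (Rpos_val @` B).
Proof.
move=> [A mA <-].
rewrite setTI [X in measurable X](_ : _ = A `&` `]0, +oo[).
  exact: measurableI.
apply/seteqP; split => [_ [y Ay <-]|y [Ay]]; rewrite /= in_itv/= andbT.
  by split => //; exact: Rpos_val_gt0.
by move=> y0; exists (PosNum y0).
Qed.

Variable n : nat.

Let density (y : measurableTypeR R) : \bar R := (y ^- n.+1)%:E.

Let density_ge0 (y : R) : 0 < y -> (0 <= density y)%E.
Proof. by move=> y0; rewrite lee_fin invr_ge0 exprn_ge0// ltW. Qed.

Let measurable_density (B : set Rpos) :
  measurable_fun (Rpos_val @` B) density.
Proof.
have mI : measurable (`]0, +oo[%classic : set (measurableTypeR R)) by exact: measurable_itv.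
apply: (measurable_funS mI).
  by move=> _ [y _ <-]; rewrite /= in_itv/= andbT; exact: Rpos_val_gt0.
apply/measurable_EFinP; apply: subspace_continuous_measurable_fun => //.
apply: continuous_in_subspaceT => y; rewrite inE/= in_itv/= andbT => y0.
apply: (@continuous_comp _ _ _ (fun x : R => x ^+ n.+1) (@GRing.inv R)).
  exact: exprn_continuous.
by apply: inv_continuous; rewrite expf_neq0// gt_eqF.
Qed.

Definition haar_Rpos (B : set Rpos) : \bar R :=
  (\int[lebesgue_measure]_(y in Rpos_val @` B) (y ^- n.+1)%:E)%E.

Let haar0 : haar_Rpos set0 = 0%E.
Proof. by rewrite /haar_Rpos image_set0 integral_set0. Qed.

Let haar_ge0 B : (0 <= haar_Rpos B)%E.
Proof. by apply: integral_ge0 => _ [y _ <-]; exact/density_ge0/Rpos_val_gt0. Qed.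

Let haar_sigma_additive : semi_sigma_additive haar_Rpos.
Proof.
move=> F mF tF mUF; rewrite /haar_Rpos image_bigcup.
rewrite ge0_integral_bigcup//=.
- apply: is_cvg_ereal_nneg_natsum_cond => k _ _; exact: haar_ge0.
- by move=> k; exact: measurable_image.
- by rewrite -image_bigcup; exact: measurable_density.
- by move=> _ [k _ [y _ <-]]; exact/density_ge0/Rpos_val_gt0.
- apply/trivIsetP => i j _ _ ij; rewrite -subset0 => _ [[y Fy <-] [z Fz]].
  move=> /val_inj zy; have /trivIsetP/(_ i j I I ij) := tF.
  by rewrite -subset0 => /(_ y); apply; split=> //; rewrite -zy.
Qed.

HB.instance Definition _ := isMeasure.Build _ _ _ haar_Rpos
  haar0 haar_ge0 haar_sigma_additive.

Let haar_sigma_finite : sigma_finite setT haar_Rpos.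
Proof.
pose I k : set (measurableTypeR R) := `[(k.+1%:R : R)^-1, k.+1%:R]%classic.
exists (fun k => Rpos_val @^-1` I k).
  apply/esym; rewrite -subTset => y _.
  pose x := Rpos_val y; have x0 := Rpos_val_gt0 y; rewrite -/x in x0.
  exists (maxn (Num.bound x) (Num.bound x^-1)) => //=.
  rewrite /I /= in_itv/= -/x; apply/andP; split.
    rewrite -[leRHS]invrK lef_pV2 ?posrE ?invr_gt0//.
    rewrite (le_trans (ltW (ltr_bound _)))// ler_nat.
    by rewrite (leq_trans (leq_maxr _ _) (leqnSn _)).
  rewrite (le_trans (ltW (ltr_bound _)))// ler_nat.
  by rewrite (leq_trans (leq_maxl _ _) (leqnSn _)).
move=> k.
have mI : measurable (Rpos_val @^-1` I k).
  by exists (I k); rewrite ?setTI//; exact: measurable_itv.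
split=> //; rewrite /haar_Rpos.
have mJ := measurable_image mI.
apply: (@le_lt_trans _ _ (\int[lebesgue_measure]_(y in
    Rpos_val @` (Rpos_val @^-1` I k)) (k.+1%:R ^+ n.+1)%:E)%E).
  apply: ge0_le_integral => //.
  - by move=> _ [y _ <-]; exact/density_ge0/Rpos_val_gt0.
  - move=> _ [y + <-]; rewrite /I /= in_itv/= => /andP[ky _].
    have y0 := Rpos_val_gt0 y.
    have Vy : (Rpos_val y : R)^-1 <= k.+1%:R.
      by rewrite -[leRHS]invrK lef_pV2 ?posrE ?invr_gt0.
    by rewrite lee_fin -exprVn lerXn2r ?nnegrE ?invr_ge0// ltW.
rewrite integral_cst//= lte_mul_pinfty// ?lee_fin ?exprn_ge0//.
apply: (@le_lt_trans _ _ (lebesgue_measure (I k))).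
  apply: le_measure; rewrite ?inE//; first exact: measurable_itv.
  by move=> _ [y yI <-].
by rewrite lebesgue_measure_itv/=; case: ifP => _; rewrite ?ltry// -EFinB ltry.
Qed.

HB.instance Definition _ := Measure_isSigmaFinite.Build _ _ _ haar_Rpos
  haar_sigma_finite.

End haar.

Notation Gn R n := (Rn R n * Rpos R)%type.

Section maximal.
Context {R : realType}.
Variable n : nat.

(* dx dy / y^(n+1) *)
Definition haar : {measure set (Gn R n) -> \bar R} :=
  (lebesgue_Rn n \x haar_Rpos n)%E.

Definition Gn_mul (p q : Gn R n) : Gn R n :=
  ([tuple (tnth p.1 i + Rpos_val p.2 * tnth q.1 i : R) | i < n],
   PosNum (mulr_gt0 (Rpos_val_gt0 p.2) (Rpos_val_gt0 q.2))).

(* (x, y) |-> (x, y e^t) *)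
Definition dil (t : R) (p : Gn R n) : Gn R n :=
  (p.1, PosNum (mulr_gt0 (Rpos_val_gt0 p.2) (expR_gt0 t))).

Lemma dilE t p : dil t p = Gn_mul p ([tuple (0 : R) | i < n], PosNum (expR_gt0 t)).
Proof.
congr pair; last exact/val_inj.
by apply: eq_from_tnth => i; rewrite !tnth_mktuple mulr0 addr0.
Qed.

Definition MLeb (f : Gn R n -> R) (p : Gn R n) : \bar R :=
  ereal_sup [set ((r^-1)%:E *
    \int[lebesgue_measure]_(t in `[0%R, r]) `|f (dil t p)|%:E)%E
  | r in [set r : R | 0 < r]].

Definition Vn (r : R) : R :=
  \int[lebesgue_measure]_(t in `[0, r]) expR (- (n%:R * t)).

Definition Mdil (f : Gn R n -> R) (p : Gn R n) : \bar R :=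
  ereal_sup [set (((Vn r)^-1)%:E *
    \int[lebesgue_measure]_(t in `[0%R, r])
      (`|f (dil t p)| * expR (- (n%:R * t)))%:E)%E
  | r in [set r : R | 0 < r]].

Definition Lp_bounded (p : \bar R) (M : (Gn R n -> R) -> Gn R n -> \bar R) :=
  exists C : R, forall f : Gn R n -> R, f \in Lfun haar p ->
    ('N[haar]_p[M f] <= C%:E * 'N[haar]_p[EFin \o f])%E.

Definition weak_type11 (M : (Gn R n -> R) -> Gn R n -> \bar R) :=
  exists C : R, forall f : Gn R n -> R, f \in Lfun haar 1%E ->
    forall lambda : R, 0 < lambda ->
    (haar [set p | lambda%:E < M f p] <=
      (C / lambda)%:E * 'N[haar]_1[EFin \o f])%E.

End maximal.

(* Main.v *)
From HB Require Import structures.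
Require Import Defs.
From mathcomp Require Import all_boot all_order all_algebra.
From mathcomp Require Import all_classical all_reals all_analysis.
From mathcomp Require Import measurable_realfun ess_sup_inf.
From mathcomp Require Import ring lra.
Import Order.TTheory GRing.Theory Num.Theory.
Import numFieldNormedType.Exports.
Local Open Scope classical_set_scope.
Local Open Scope ring_scope.

(** Everything happens in the variable y.  In the coordinate s = ln y the Haar
    measure is dx e^(-ns) ds and dilations are translations.  In the coordinate
    v = y^(-n) the measure dy / y^(n+1) is, up to the factor n, Lebesgue
    measure on the half-line, and the averages that define Mdil are plain averages
    of the slice f (x, .) over intervals with right end v.  So Mdil is dominated,
    slice by slice, by twice the Hardy-Littlewood maximal function of a function
    of one real variable (dil_avg_HL), and the maximal inequality gives the weak
    type (1,1) on slices, then on the whole group by Tonelli's theorem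
    (Mdil_weak).

    The averages of Mdil have total weight 1, so a function bounded by l
    contributes at most l to Mdil.  Truncating f at height l and applying the weak
    bound to the large part only yields boundedness on L^p for 1 < p <= oo
    (marcinkiewicz, strong_type_oo).  Both changes of variables are instances of
    the substitution y = a e^(ct) for measurable functions (exp_substitution),
    and so is the layer cake formula behind the interpolation.

    The negative statements all come from the indicator f of the box
    [0, 1]^n x [1, e].  At (x, e^(-u)) with x in the cube and u >= 0, MLeb f is
    at least 1 / (u + 1), whereas the slab of heights e^(-m-1) <= y <= e^(-m) has
    measure at least e^(nm); hence l^p times the measure of {MLeb f > l} is
    unbounded as l tends to 0 (MLeb_level_unbounded), which excludes the weak type
    and, by Chebyshev's inequality, every L^p bound.  At the same points Mdil f is
    at least a constant times e^(-nu), which is integrable to every power p > 1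
    against e^(nu) du, but not for p = 1 (Mdil_not_L1_bounded). *)

Set Implicit Arguments.
Unset Strict Implicit.
Unset Printing Implicit Defensive.

(** * Integration against a density *)

Section density.
Local Open Scope ereal_scope.
Context {d1 d2} {X : measurableType d1} {Y : measurableType d2} {R : realType}.
Variables (nu : {measure set X -> \bar R}) (mu : {measure set Y -> \bar R}).
Variables (D : set Y) (mD : measurable D).
Variables (phi : X -> Y) (mphi : measurable_fun setT phi).
Variables (w : X -> R) (mw : measurable_fun setT w).
Hypothesis w0 : forall x, (0 <= w x)%R.
Hypothesis muE : forall B, measurable B ->
  mu (B `&` D) = \int[nu]_x ((\1_B (phi x))%:E * (w x)%:E).

Import HBNNSimple.

(** Both sides are linear in f and continuous along increasing sequences, so
    the case of indicator functions, which is the hypothesis, gives simple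
    functions and then all nonnegative measurable ones.  This turns every
    identity between measures of sets below into a change of variables. *)
Lemma ge0_integral_density (f : Y -> \bar R) :
  measurable_fun setT f -> (forall y, 0 <= f y) ->
  \int[mu]_(y in D) f y = \int[nu]_x (f (phi x) * (w x)%:E).
Proof.
move=> mf f0; pose g := nnsfun_approx measurableT mf.
have gE n : \int[mu]_(y in D) (g n y)%:E = \int[nu]_x ((g n (phi x))%:E * (w x)%:E).
  have mI k : measurable (g n @^-1` [set k]) by [].
  transitivity (\sum_(k \in range (g n))
      \int[mu]_(y in D) (k * \1_(g n @^-1` [set k]) y)%:E).
    rewrite -ge0_integral_fsum//.
    - by apply: eq_integral => y _; rewrite fsumEFin// -fimfunE.
    - by move=> k; apply/measurable_EFinP; exact: measurable_funM.
    - by move=> k y _; rewrite nnfun_muleindic_ge0.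
  transitivity (\sum_(k \in range (g n))
      \int[nu]_x ((k * \1_(g n @^-1` [set k]) (phi x))%:E * (w x)%:E)).
    apply: eq_fsbigr => k /[!inE] -[y _ <-].
    rewrite integralZl_indic_nnsfun// integral_indic// muE//.
    under [RHS]eq_integral do rewrite EFinM -muleA.
    rewrite ge0_integralZl//.
    - apply: emeasurable_funM => //; apply/measurable_EFinP => //.
      by apply: measurableT_comp.
    - by move=> x _; rewrite mule_ge0// lee_fin.
    - by rewrite lee_fin; exact: fun_ge0.
  rewrite -ge0_integral_fsum//.
  - apply: eq_integral => x _; rewrite [in RHS]fimfunE -fsumEFin//.
    by rewrite ge0_mule_fsuml// => r; exact: nnfun_muleindic_ge0.
  - move=> k; apply: emeasurable_funM; apply/measurable_EFinP => //.
    by apply: measurable_funM => //; apply: measurableT_comp.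
  - by move=> k x _; apply: mule_ge0; [rewrite EFinM nnfun_muleindic_ge0|rewrite lee_fin].
have gf y : (g n y)%:E @[n --> \oo] --> f y by exact: cvg_nnsfun_approx.
have mgw n : measurable_fun setT (fun x => (g n (phi x))%:E * (w x)%:E).
  apply: emeasurable_funM; apply/measurable_EFinP => //.
  exact: measurableT_comp.
transitivity (limn (fun n => \int[mu]_(y in D) (g n y)%:E)).
  rewrite -monotone_convergence//.
  - by apply: eq_integral => y _; apply/esym/cvg_lim => //; exact: gf.
  - by move=> n; apply/measurable_EFinP; exact: measurable_funTS.
  - by move=> n y _; rewrite lee_fin; exact: fun_ge0.
  - by move=> y _ m n mn; rewrite lee_fin; exact/lefP/nd_nnsfun_approx.
under eq_fun do rewrite gE.
rewrite -monotone_convergence//.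
- apply: eq_integral => x _; apply/cvg_lim => //.
  by apply: cvgeZr => //; exact: gf.
- by move=> n x _; rewrite mule_ge0// lee_fin//; exact: fun_ge0.
- move=> x _ m n mn; apply: lee_wpmul2r; first by rewrite lee_fin.
  by rewrite lee_fin; exact/lefP/nd_nnsfun_approx.
Qed.
End density.

(** * Exponential substitution in the Lebesgue integral *)

Lemma integral_expR {R : realType} (c u v : R) : c != 0 -> u < v ->
  (\int[lebesgue_measure]_(t in `[u, v]) (expR (c * t))%:E =
   ((expR (c * v) - expR (c * u)) / c)%:E)%E.
Proof.
move=> c0 uv; pose F t : R := expR (c * t) / c.
have dF (t : R) : is_derive t (1 : R) (F : R -> R^o) (expR (c * t)).
  have dc : is_derive t 1 ( *%R c) c.
    by apply: is_derive_eq; rewrite ?scaler1//= /GRing.scale/= mulr1.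
  have de : is_derive t 1 (expR \o *%R c) (expR (c * t) * c).
    exact: is_derive1_comp.
  have -> : F = c^-1 \*: (expR \o *%R c : R -> R^o).
    by apply/funext => x; rewrite /F /= mulrC.
  by apply: is_derive_eq; rewrite /GRing.scale/= mulrCA mulVf ?mulr1.
have cF : continuous F.
  by move=> t; apply/differentiable_continuous/derivable1_diffP.
have ce : continuous (fun t : R => expR (c * t)).
  move=> t; apply: (@continuous_comp _ _ _ ( *%R c) expR).
    by apply: cvgM; [exact: cvg_cst|exact: cvg_id].
  exact: continuous_expR.
rewrite (@continuous_FTC2 _ (fun t => expR (c * t)) F)//.
- by rewrite -EFinB mulrBl.
- exact: continuous_subspaceT.
- split => //.
  + exact: (cvg_at_right_filter (cF u)).
  + exact: (cvg_at_left_filter (cF v)).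
- by move=> t _; rewrite derive1E; apply: derive_val; exact: dF.
Qed.

Lemma measurable_exp_scaled {R : realType} (a c : R) :
  measurable_fun [set: R] (fun t : R => a * expR (c * t)).
Proof.
apply: measurable_funM => //; apply: measurableT_comp; first exact: measurable_expR.
exact: measurable_funM.
Qed.

Section exp_substitution.
Context {R : realType}.
Variables (a c : R) (a0 : 0 < a) (c0 : c != 0).
Notation leb := (@lebesgue_measure R).
Let phi (t : R) : R := a * expR (c * t).
Let psi (y : R) : R := ln (y / a) / c.
Let w (t : R) : R := a * `|c| * expR (c * t).

Let phi_gt0 t : 0 < phi t. Proof. by rewrite mulr_gt0// expR_gt0. Qed.
Let w_ge0 t : 0 <= w t. Proof. by rewrite !mulr_ge0 ?expR_ge0// ltW. Qed.

Let psiK y : 0 < y -> phi (psi y) = y.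
Proof.
move=> y0; rewrite /psi /phi mulrCA divff// mulr1 lnK ?posrE ?divr_gt0//.
by rewrite mulrC divfK// gt_eqF.
Qed.

Let measurable_phi : measurable_fun setT phi.
Proof. exact: measurable_exp_scaled. Qed.

Let measurable_w : measurable_fun setT w.
Proof. exact: measurable_exp_scaled. Qed.

Let measurable_psi : measurable_fun setT psi.
Proof.
apply: measurable_funM => //; apply: measurableT_comp; first exact: measurable_ln.
exact: measurable_funM.
Qed.

(* The primitive of w, increasing whatever the sign of c. *)
Let F (t : R) : R := Num.sg c * phi t.

Let integral_w (u v : R) : u < v ->
  (\int[leb]_(t in `]u, v]) (w t)%:E = (F v - F u)%:E)%E.
Proof.
move=> uv; have mce : measurable_fun [set: R] (fun t : R => expR (c * t)).
  by apply: measurableT_comp => //; exact: measurable_funM.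
rewrite integral_itv_obnd_cbnd; last first.
  by apply/measurable_EFinP; exact: measurable_funTS.
rewrite /w; under eq_integral do rewrite EFinM.
rewrite ge0_integralZl//; last 2 first.
- by apply/measurable_EFinP; exact: (measurable_funTS mce).
- by rewrite lee_fin mulr_ge0// ltW.
rewrite integral_expR// -EFinM; congr EFin; rewrite /F /phi normrEsg.
by field.
Qed.

Let psi_itv (u v : R) : u < v ->
  leb ((psi @^-1` `]u, v]) `&` `]0, +oo[) = (F v - F u)%:E.
Proof.
move=> uv; have [cp|cn] := ltP 0 c.
  rewrite (_ : _ `&` _ = `]phi u, phi v]%classic); last first.
    apply/seteqP; split => y /=; rewrite !in_itv/= ?andbT.
      move=> [/andP[uy yv] y0]; rewrite -(psiK y0) /phi !(ltr_pM2l,ler_pM2l)//.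
      by rewrite ltr_expR ler_expR !(ltr_pM2l,ler_pM2l)// uy.
    move=> /andP[uy yv]; have y0 := lt_trans (phi_gt0 u) uy; split => //.
    move: uy yv; rewrite -{1 2}(psiK y0) /phi !(ltr_pM2l,ler_pM2l)//.
    by rewrite ltr_expR ler_expR !(ltr_pM2l,ler_pM2l)// => -> ->.
  rewrite lebesgue_measure_itv/= lte_fin ifT.
    by rewrite -EFinB /F gtr0_sg// !mul1r.
  by rewrite /phi ltr_pM2l// ltr_expR ltr_pM2l.
have {}cn : c < 0 by rewrite lt_neqAle c0.
rewrite (_ : _ `&` _ = `[phi v, phi u[%classic); last first.
  apply/seteqP; split => y /=; rewrite !in_itv/= ?andbT.
    move=> [/andP[uy yv] y0]; rewrite -(psiK y0) /phi !(ltr_pM2l,ler_pM2l)//.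
    by rewrite ltr_expR ler_expR !(ltr_nM2l,ler_nM2l)// uy andbT.
  move=> /andP[vy yu]; have y0 := lt_le_trans (phi_gt0 v) vy; split => //.
  move: vy yu; rewrite -{1 2}(psiK y0) /phi !(ltr_pM2l,ler_pM2l)//.
  by rewrite ltr_expR ler_expR !(ltr_nM2l,ler_nM2l)// => -> ->.
rewrite lebesgue_measure_itv/= lte_fin ifT.
  by rewrite -EFinB /F ltr0_sg// !mulN1r opprK addrC.
by rewrite /phi ltr_pM2l// ltr_expR ltr_nM2l.
Qed.

Let nu1 (B : set (measurableTypeR R)) : \bar R := leb ((psi @^-1` B) `&` `]0, +oo[).
Let nu2 (B : set (measurableTypeR R)) : \bar R := (\int[leb]_(t in B) (w t)%:E)%E.

Let nu10 : nu1 set0 = 0%E.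
Proof. by rewrite /nu1 preimage_set0 set0I measure0. Qed.
Let nu1_ge0 B : (0 <= nu1 B)%E. Proof. exact: measure_ge0. Qed.
Let nu1_sa : semi_sigma_additive nu1.
Proof.
move=> G mG tG mUG; rewrite /nu1.
have mpsi B : measurable B -> measurable (psi @^-1` B).
  by move=> mB; rewrite -[X in measurable X]setTI; exact: measurable_psi.
have mI : measurable (`]0, +oo[ : set (measurableTypeR R)) by exact: measurable_itv.
rewrite preimage_bigcup setI_bigcupl.
apply: measure_semi_sigma_additive => //.
- by move=> i; apply: measurableI => //; exact: (mpsi _ (mG i)).
- apply/trivIsetP => i j _ _ ij; rewrite setIACA -preimage_setI.
  by move/trivIsetP : tG => /(_ _ _ Logic.I Logic.I ij) ->; rewrite preimage_set0 set0I.
- rewrite -setI_bigcupl -preimage_bigcup.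
  by apply: measurableI => //; exact: (mpsi _ mUG).
Qed.
HB.instance Definition _ := isMeasure.Build _ _ _ nu1 nu10 nu1_ge0 nu1_sa.

Let nu20 : nu2 set0 = 0%E. Proof. exact: integral_set0. Qed.
Let nu2_ge0 B : (0 <= nu2 B)%E.
Proof. by apply: integral_ge0 => t _; rewrite lee_fin. Qed.
Let nu2_sa : semi_sigma_additive nu2.
Proof.
move=> G mG tG mUG; rewrite /nu2 ge0_integral_bigcup//=.
- apply: is_cvg_ereal_nneg_natsum_cond => k _ _; exact: nu2_ge0.
- by apply: measurable_funTS; exact/measurable_EFinP.
- by move=> t _; rewrite lee_fin.
Qed.
HB.instance Definition _ := isMeasure.Build _ _ _ nu2 nu20 nu2_ge0 nu2_sa.

Let nuE B : measurable B -> nu1 B = nu2 B.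
Proof.
pose m1 : {measure set (measurableTypeR R) -> \bar R} := nu1.
pose m2 : {measure set (measurableTypeR R) -> \bar R} := nu2.
move=> mB; rewrite -[LHS]/(m1 B) -[RHS]/(m2 B).
apply: (@measure_unique _ _ (measurableTypeR R) (@ocitv R)
  (fun k : nat => `](- k%:R)%R, k%:R]%classic) _ _ _ _ m1 m2) => //.
- exact: ocitvI.
- by move=> k; exists (-k%:R, k%:R).
- by rewrite bigcup_itvT.
- move=> _ [[u v] _ <-] /=; have [uv|vu] := ltP u v.
    by rewrite /nu1 /nu2 psi_itv// integral_w.
  by rewrite set_itv_ge ?measure0// bnd_simp -leNgt.
- move=> k; have [uv|vu] := ltP (- k%:R : R) k%:R.
    by rewrite /= /nu1 psi_itv// ltry.
  by rewrite set_itv_ge ?measure0// bnd_simp -leNgt.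
Qed.

(** The integrand is only measurable, so the substitution y = a e^(ct) is not
    obtained from the chain rule: it is an equality of two measures on the
    t-line, the image nu1 of Lebesgue measure on the half-line under the
    inverse map and the measure nu2 of density a |c| e^(ct), which agree on
    the intervals ]u, v] by the fundamental theorem of calculus. *)
Lemma exp_substitution (g : R -> \bar R) :
  measurable_fun setT g -> (forall y, (0 <= g y)%E) ->
  (\int[leb]_(y in `]0%R, +oo[) g y =
   \int[leb]_t (g (a * expR (c * t))%R * (a * `|c| * expR (c * t))%:E))%E.
Proof.
move=> mg g0; apply: (@ge0_integral_density _ _ _ _ _ leb leb _ _ phi _ w) => //.
move=> B mB; have mphiB : measurable (phi @^-1` B).
  by rewrite -[X in measurable X]setTI; exact: measurable_phi.
transitivity (nu1 (phi @^-1` B)).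
  congr (leb _); apply/seteqP; split => y /=; rewrite in_itv/= andbT.
    by move=> [By y0]; split => //; rewrite psiK.
  by move=> [By y0]; split => //; rewrite psiK in By.
rewrite nuE// /nu2 [LHS]integral_mkcond.
apply: eq_integral => t _; rewrite patchE indicE (_ : (t \in _) = (phi t \in B)).
  by case: ifPn; rewrite ?mul1e ?mul0e.
by apply/idP/idP; rewrite !inE.
Qed.

End exp_substitution.

(** * Logarithmic coordinates for the Haar measure *)

Section coordinates.
Context {R : realType}.
Notation leb := (@lebesgue_measure R).

Definition Rexp (s : R) : Rpos R := PosNum (expR_gt0 s).

Lemma Rpos_val_Rexp s : Rpos_val (Rexp s) = expR s. Proof. by []. Qed.

Lemma ln_RposK (y : Rpos R) : Rexp (ln (Rpos_val y)) = y.
Proof. by apply/val_inj; rewrite /= lnK// posrE Rpos_val_gt0. Qed.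

Lemma measurable_Rpos_val : measurable_fun setT (@Rpos_val R).
Proof.
move=> _ B mB; rewrite setTI; exists B => //; by rewrite setTI.
Qed.

Lemma measurable_to_Rpos {d} {T : measurableType d} (h : T -> Rpos R) :
  measurable_fun setT (@Rpos_val R \o h) -> measurable_fun setT h.
Proof.
move=> mh _ B [A mA <-]; rewrite setTI setTI -comp_preimage -[X in measurable X]setTI.
exact: mh.
Qed.

Lemma measurable_Rexp : measurable_fun setT Rexp.
Proof. by apply: measurable_to_Rpos; exact: measurable_expR. Qed.

Lemma dil_Rexp n t (x : Rn R n) s : dil t (x, Rexp s) = (x, Rexp (s + t)).
Proof. by congr pair; apply/val_inj; rewrite /= expRD. Qed.

(** With y = e^s, dy / y^(n+1) = e^(-ns) ds. *)
Lemma integral_haar_Rpos n (g : Rpos R -> \bar R) :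
  measurable_fun setT g -> (forall y, (0 <= g y)%E) ->
  (\int[haar_Rpos n]_y g y =
   \int[leb]_s (g (Rexp s) * (expR (- (n%:R * s)))%:E))%E.
Proof.
move=> mg g0.
apply: (@ge0_integral_density _ _ _ _ _ leb (haar_Rpos n) _ _ Rexp _
  (fun s => expR (- (n%:R * s)))) => //.
- exact: measurable_Rexp.
- apply: measurableT_comp; first exact: measurable_expR.
  by apply: measurableT_comp => //; exact: measurable_funM.
move=> B mB; rewrite setIT.
transitivity (\int[leb]_(y in @Rpos_val R @` B) (y ^- n.+1)%:E)%E; first by [].
pose B' : set R := [set y | B (Rexp (ln y))].
have mB' : measurable B'.
  rewrite -[X in measurable X]setTI.
  by apply: (measurableT_comp measurable_Rexp (@measurable_ln R)).
rewrite (_ : @Rpos_val R @` B = B' `&` `]0%R, +oo[); last first.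
  apply/seteqP; split => [_ [y By <-]|y [By]] /=; rewrite in_itv/= andbT.
    by split; rewrite ?Rpos_val_gt0// /B' /= ln_RposK.
  by move=> y0; exists (Rexp (ln y)) => //; rewrite Rpos_val_Rexp lnK.
rewrite integral_mkcondl.
transitivity (\int[leb]_(y in `]0%R, +oo[)
   (((fun y => (expR (- (n.+1%:R * ln y)))%:E) \_ B') y))%E.
  apply: eq_integral => y; rewrite inE/= in_itv/= andbT => y0.
  rewrite !patchE; case: ifPn => // _; congr EFin.
  by rewrite expRN mulrC expRM_natr lnK.
rewrite (@exp_substitution _ 1 1)//; last 2 first.
- apply/(measurable_restrictT _ _).1 => //; apply: measurable_funTS.
  apply/measurable_EFinP; apply: measurableT_comp; first exact: measurable_expR.
  by apply: measurableT_comp => //; apply: measurable_funM => //; exact: measurable_ln.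
- by move=> y; apply: erestrict_ge0 => // z _; rewrite lee_fin expR_ge0.
apply: eq_integral => s _; rewrite !mul1r normr1 mul1r patchE indicE.
rewrite (_ : (_ \in B') = (Rexp s \in B)); last first.
  by apply/idP/idP; rewrite !inE /B'/= expRK.
case: ifPn => _; rewrite ?mul0e// mul1e -EFinM -expRD expRK; congr (expR _)%:E.
by rewrite -natr1; ring.
Qed.

Lemma haar_integral n (F : Gn R n -> \bar R) :
  measurable_fun setT F -> (forall p, (0 <= F p)%E) ->
  (\int[haar n]_p F p = \int[lebesgue_Rn n]_x \int[leb]_s
     (F (x, Rexp s) * (expR (- (n%:R * s)))%:E))%E.
Proof.
move=> mF F0; rewrite /haar fubini_tonelli1//; apply: eq_integral => x _.
rewrite /fubini_F integral_haar_Rpos//.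
by apply: measurableT_comp.
Qed.


Lemma haar_setX n (A : set (Rn R n)) (B : set (Rpos R)) :
  measurable A -> measurable B ->
  haar n (A `*` B) = (lebesgue_Rn n A * haar_Rpos n B)%E.
Proof. exact: product_measure1E. Qed.

Lemma haar_sigma_finite n : sigma_finite setT (haar n : set (Gn R n) -> \bar R).
Proof.
have /sigma_finiteP[F [TF ndF Foo]] := sigma_finiteT (@lebesgue_Rn R n).
have /sigma_finiteP[G [TG ndG Goo]] := sigma_finiteT (@haar_Rpos R n).
exists (fun k => F k `*` G k) => [|k].
  apply/esym; rewrite -subTset => -[x y] _.
  have [i _ Fi] : (\bigcup_i F i) x by rewrite -TF.
  have [j _ Gj] : (\bigcup_i G i) y by rewrite -TG.
  exists (maxn i j) => //; split.
  - by have /subsetPset := ndF _ _ (leq_maxl i j); exact.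
  - by have /subsetPset := ndG _ _ (leq_maxr i j); exact.
have [mF Fk] := Foo k; have [mG Gk] := Goo k.
split; first exact: measurableX.
by rewrite haar_setX// lte_mul_pinfty// ge0_fin_numE.
Qed.

(** The Haar measure bundled with its sigma-finiteness, which Tonelli's theorem
    requires. *)
Definition sigma_finite_haar n : {sigma_finite_measure set (Gn R n) -> \bar R} :=
  HB.pack (haar n : set (Gn R n) -> \bar R) (haar n : {measure set (Gn R n) -> \bar R})
   (@Measure_isSigmaFinite.Build _ _ _ (haar n) (haar_sigma_finite n)).
End coordinates.

(** * Weighted maximal operators along dilations: measurability *)

Section dil_max.
Context {R : realType} {n : nat}.
Notation leb := (@lebesgue_measure R).
Implicit Types (c w : R -> R) (f : Gn R n -> R).

(** Both maximal operators are suprema of weighted averages along dilations: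
    c r = 1/r and w = 1 give MLeb, c r = 1/V_n(r) and w t = e^(-nt) give Mdil.
    What depends only on this shape is proved once. *)
Definition dil_avg c w f (r : R) (p : Gn R n) : \bar R :=
  ((c r)%:E * \int[leb]_(t in `[0%R, r]) (`|f (dil t p)| * w t)%:E)%E.

Definition dil_max c w f (p : Gn R n) : \bar R :=
  ereal_sup [set dil_avg c w f r p | r in [set r : R | 0 < r]].

Lemma measurable_dil :
  measurable_fun setT (fun z : Gn R n * measurableTypeR R => dil z.2 z.1).
Proof.
apply/measurable_fun_pairP; split.
  rewrite (_ : _ \o _ = fst \o fst)//.
  by apply: measurableT_comp.
apply: measurable_to_Rpos.
rewrite (_ : _ \o _ = fun z : Gn R n * measurableTypeR R =>
   Rpos_val z.1.2 * expR z.2)//.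
apply: measurable_funM.
  apply: (@measurableT_comp _ _ _ _ _ _ (@Rpos_val R)); first exact: measurable_Rpos_val.
  by apply: measurableT_comp.
by apply: (@measurableT_comp _ _ _ _ _ _ (@expR R)).
Qed.

Section measurability.
Variables (c w : R -> R) (f : Gn R n -> R).
Hypothesis w0 : forall t, 0 <= w t.
Hypothesis mw : measurable_fun setT w.
Hypothesis mf : measurable_fun setT f.

Let mfdil : measurable_fun setT (fun z : Gn R n * measurableTypeR R =>
   (`|f (dil z.2 z.1)| * w z.2)%:E).
Proof.
apply/measurable_EFinP; apply: measurable_funM.
  apply: measurableT_comp => //; apply: measurableT_comp => //.
  exact: measurable_dil.
by apply: measurableT_comp.
Qed.

Lemma measurable_dil_slice p :
  measurable_fun setT (fun t : measurableTypeR R => (`|f (dil t p)| * w t)%:E).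
Proof. exact: (measurableT_comp mfdil (measurable_pair1 p)). Qed.

Let I r p := (\int[leb]_(t in `[0%R, r]) (`|f (dil t p)| * w t)%:E)%E.

Lemma measurable_dil_avg r : measurable_fun setT (dil_avg c w f r).
Proof.
apply: measurable_funeM.
pose g (z : Gn R n * measurableTypeR R) : \bar R :=
  ((`|f (dil z.2 z.1)| * w z.2)%:E * (\1_(`[0, r]%classic : set R) z.2)%:E)%E.
have mI : measurable (`[0, r]%classic : set (measurableTypeR R)) by exact: measurable_itv.
have mg : measurable_fun setT g.
  apply: emeasurable_funM => //; apply/measurable_EFinP.
  by apply: measurableT_comp => //; exact: measurable_indic.
rewrite (_ : (fun _ => _) = fubini_F leb g).
  apply: measurable_fun_fubini_tonelli_F => // z.
  by rewrite mule_ge0 ?lee_fin// mulr_ge0.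
apply/funext => p; rewrite /fubini_F /g [LHS]integral_mkcond; apply: eq_integral => t _.
by rewrite patchE indicE /=; case: ifPn; rewrite ?mule1 ?mule0.
Qed.

Let I_nd r s p : r <= s -> (I r p <= I s p)%E.
Proof.
move=> rs; apply: ge0_subset_integral => //.
- by apply: measurable_funTS; exact: measurable_dil_slice.
- by move=> t _; rewrite lee_fin mulr_ge0.
- by apply: subset_itvl; rewrite bnd_simp.
Qed.

Hypothesis c0 : forall r, 0 < r -> 0 < c r.
Hypothesis cc : forall r, 0 < r -> {for r, continuous c}.

(* The integral in dil_avg is nondecreasing in r and c is continuous, so if the
   average exceeds a at some r it still does at slightly larger radii, among
   which there is a rational one. *)
Let rat_reduction a p : (a%:E < dil_max c w f p)%E <->
  exists2 q : rat, 0 < q & (a%:E < dil_avg c w f (ratr q) p)%E.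
Proof.
split; last first.
  move=> [q q0 aq]; apply: (lt_le_trans aq); apply: ereal_sup_ubound.
  by exists (ratr q) => //=; rewrite ltr0q.
move=> /ereal_sup_gt[_ [r /= r0 <-]] ar.
have /= I0 : (0 <= I r p)%E.
  by apply: integral_ge0 => t _; rewrite lee_fin mulr_ge0.
suff [s rs sa] : exists2 s, r < s & forall q, r < q -> q < s -> (a%:E < dil_avg c w f q p)%E.
  have [q] := rat_in_itvoo rs; rewrite in_itv/= => /andP[rq qs].
  exists q; last exact: sa.
  by rewrite -(ltr0q R) (lt_trans r0).
have : \forall q \near r, (a%:E < (c q)%:E * I r p)%E.
  move: ar; rewrite /dil_avg -/(I r p); case: (I r p) I0 => [x x0|_ _|//].
  - rewrite -EFinM lte_fin => ar; near=> q.
    rewrite lte_fin; near: q.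
    have cx : (fun q => c q * x) q @[q --> r] --> c r * x.
      by apply: cvgM; [exact: cc|exact: cvg_cst].
    exact: (cvgr_gt _ cx).
  - near=> q.
    have q0 : 0 < q by near: q; exact: lt_nbhsr.
    by rewrite gt0_muley ?lte_fin ?c0// ltry.
move=> /nbhs_ballP[e /= e0 He]; exists (r + e); first by rewrite ltrDl.
move=> q rq qre; have q0 := lt_trans r0 rq.
apply: (@lt_le_trans _ _ ((c q)%:E * I r p)%E).
  by apply: He; rewrite /ball/= ltr_distlC; apply/andP; split; lra.
by apply: lee_wpmul2l; [rewrite lee_fin ltW// c0|exact/I_nd/ltW].
Unshelve. all: by end_near. Qed.

(** The supremum over all radii is a supremum over rational ones, hence
    countable. *)
Lemma measurable_dil_max : measurable_fun setT (dil_max c w f).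
Proof.
apply: (measurability _ (ErealGenOInfty.measurableE R)) => /= _ [_ [a ->]] <-.
rewrite setTI preimage_itvoy (_ : [set _ | _] = \bigcup_(q : rat)
    (if (0 < q)%R then [set p | a%:E < dil_avg c w f (ratr q) p]%E else set0)).
  apply: bigcupT_measurable_rat => q; case: ifPn => // _.
  rewrite -[X in measurable X]setTI; apply: emeasurable_fun_o_infty => //.
  exact: measurable_dil_avg.
apply/seteqP; split => p /=.
  by move=> /rat_reduction[q q0 aq]; exists q => //; rewrite q0.
move=> [q _]; case: ifPn => // q0 /= aq; apply/rat_reduction; by exists q.
Qed.
End measurability.
End dil_max.

(** * Normalized weights and truncation *)

(** The half of the Marcinkiewicz splitting that carries the large values of f;
    the other half is bounded by l and is only ever estimated by l. *)
Definition above {R : realType} {T : Type} (l : R) (f : T -> R) (x : T) : R :=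
  if l < `|f x| then f x else 0.

Lemma measurable_above {R : realType} {d} {T : measurableType d} (l : R) (f : T -> R) :
  measurable_fun setT f -> measurable_fun setT (above l f).
Proof.
move=> mf; apply: measurable_fun_ifT => //.
by apply: measurable_fun_ltr => //; exact: measurableT_comp.
Qed.

Section dil_max_properties.
Context {R : realType} {n : nat}.
Notation leb := (@lebesgue_measure R).
Variables (c w : R -> R).
Hypothesis w0 : forall t, 0 <= w t.
Hypothesis mw : measurable_fun setT w.
Hypothesis c0 : forall r, 0 < r -> 0 < c r.

Lemma dil_max_ge0 (f : Gn R n -> R) p : (0 <= dil_max c w f p)%E.
Proof.
apply: le_trans (ereal_sup_ubound _); last by exists 1; rewrite /= ?ltr01.
apply: mule_ge0; first by rewrite lee_fin ltW// c0.
by apply: integral_ge0 => t _; rewrite lee_fin mulr_ge0.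
Qed.

Hypothesis cw1 : forall r, 0 < r ->
  ((c r)%:E * \int[leb]_(t in `[0%R, r]) (w t)%:E = 1)%E.

(** The averages have total weight 1 (hypothesis cw1), so replacing f by its
    large part changes each of them by at most l. *)
Lemma dil_max_above (f : Gn R n -> R) (l : R) p : measurable_fun setT f -> 0 <= l ->
  (dil_max c w f p <= dil_max c w (above l f) p + l%:E)%E.
Proof.
move=> mf l0; apply: ge_ereal_sup => _ [r /= r0 <-].
apply: (@le_trans _ _ (dil_avg c w (above l f) r p + l%:E)%E); last first.
  by apply: leeD => //; apply: ereal_sup_ubound; exists r.
have mI : measurable (`[0, r]%classic : set (measurableTypeR R)) by exact: measurable_itv.
rewrite /dil_avg -[X in (_ + X)%E]mule1 -(cw1 r0) muleCA -ge0_muleDr//; last 2 first.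
- by apply: integral_ge0 => t _; rewrite lee_fin mulr_ge0.
- by rewrite mule_ge0 ?lee_fin// integral_ge0// => t _; rewrite lee_fin.
apply: lee_wpmul2l; first by rewrite lee_fin ltW// c0.
have mEw : measurable_fun (`[0, r]%classic : set (measurableTypeR R)) (EFin \o w).
  by apply/measurable_EFinP; exact: measurable_funTS.
rewrite -ge0_integralZl//; last first.
  by move=> t _; rewrite lee_fin.
have ma := measurable_above l mf.
rewrite -ge0_integralD//=; last 4 first.
- by move=> t _; rewrite lee_fin mulr_ge0.
- by apply: measurable_funTS; exact: measurable_dil_slice.
- by move=> t _; rewrite -EFinM lee_fin mulr_ge0.
- exact: measurable_funeM.
apply: ge0_le_integral => //=.
- by move=> t _; rewrite lee_fin mulr_ge0.
- by apply: measurable_funTS; exact: measurable_dil_slice.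
- apply: emeasurable_funD; last exact: measurable_funeM.
  by apply: measurable_funTS; exact: measurable_dil_slice.
move=> t _; rewrite -EFinM -EFinD lee_fin -mulrDl ler_wpM2r// /above.
by case: ltP => h; rewrite ?lerDl// normr0 add0r.
Qed.

End dil_max_properties.

Section MLeb_Mdil.
Context {R : realType} (n : nat).
Notation leb := (@lebesgue_measure R).

Lemma MLebE (f : Gn R n -> R) : MLeb f = dil_max GRing.inv (cst 1) f.
Proof.
apply/funext => p; congr ereal_sup; apply/eq_imagel => r /= r0; congr (_ * _)%E.
by apply: eq_integral => t _; rewrite /cst mulr1.
Qed.

Definition exp_weight (t : R) : R := expR (- (n%:R * t)).

Lemma MdilE (f : Gn R n -> R) : Mdil f = dil_max (fun r => (Vn n r)^-1) exp_weight f.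
Proof. by []. Qed.

Lemma exp_weight_ge0 t : 0 <= exp_weight t. Proof. exact: expR_ge0. Qed.

Lemma measurable_exp_weight : measurable_fun setT exp_weight.
Proof.
apply: measurableT_comp; first exact: measurable_expR.
by apply: measurableT_comp => //; exact: measurable_funM.
Qed.

Hypothesis n1 : (1 <= n)%N.
Let n0 : 0 < n%:R :> R. Proof. by rewrite ltr0n. Qed.

Lemma integral_exp_weight (r : R) : 0 < r ->
  (\int[leb]_(t in `[0%R, r]) (exp_weight t)%:E = ((1 - expR (- (n%:R * r))) / n%:R)%:E)%E.
Proof.
move=> r0; under eq_integral do rewrite /exp_weight -mulNr.
rewrite integral_expR ?oppr_eq0 ?gt_eqF// mulr0 expR0 mulNr; congr EFin.
by rewrite invrN mulrN -mulNr opprB.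
Qed.

Lemma VnE (r : R) : 0 < r -> Vn n r = (1 - expR (- (n%:R * r))) / n%:R.
Proof. by move=> r0; rewrite /Vn /Rintegral integral_exp_weight. Qed.

Lemma Vn_gt0 (r : R) : 0 < r -> 0 < Vn n r.
Proof.
move=> r0; rewrite VnE// divr_gt0// subr_gt0 -[ltRHS]expR0 ltr_expR.
by rewrite oppr_lt0 mulr_gt0.
Qed.

Lemma Vn_avg (r : R) : 0 < r ->
  (((Vn n r)^-1)%:E * \int[leb]_(t in `[0%R, r]) (exp_weight t)%:E = 1)%E.
Proof.
by move=> r0; rewrite integral_exp_weight// -VnE// -EFinM mulVf// gt_eqF// Vn_gt0.
Qed.

Lemma continuous_VnV (r : R) : 0 < r -> {for r, continuous (fun r => (Vn n r)^-1)}.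
Proof.
move=> r0; apply: cvgV; first by rewrite gt_eqF// Vn_gt0.
have H : ((1 - exp_weight q) / n%:R) @[q --> r] --> (1 - exp_weight r) / n%:R.
  apply: cvgM; last exact: cvg_cst.
  apply: cvgB; first exact: cvg_cst.
  rewrite /exp_weight; apply: continuous_cvg; first exact: continuous_expR.
  by apply: cvgN; apply: cvgM; [exact: cvg_cst|exact: cvg_id].
rewrite [X in _ --> X](VnE r0); apply: cvg_trans H; apply: near_eq_cvg; near=> q.
by rewrite VnE//; near: q; exact: lt_nbhsr.
Unshelve. all: by end_near. Qed.

Lemma measurable_Mdil (f : Gn R n -> R) :
  measurable_fun setT f -> measurable_fun setT (Mdil f).
Proof.
move=> mf; rewrite MdilE; apply: measurable_dil_max => //.
- exact: exp_weight_ge0.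
- exact: measurable_exp_weight.
- by move=> r r0; rewrite invr_gt0 Vn_gt0.
- exact: continuous_VnV.
Qed.

Lemma measurable_MLeb (f : Gn R n -> R) :
  measurable_fun setT f -> measurable_fun setT (MLeb f).
Proof.
move=> mf; rewrite MLebE; apply: measurable_dil_max => //.
- by move=> r r0; rewrite invr_gt0.
- by move=> r r0; apply: inv_continuous; rewrite gt_eqF.
Qed.

Lemma Mdil_ge0 (f : Gn R n -> R) p : (0 <= Mdil f p)%E.
Proof.
by rewrite MdilE; apply: dil_max_ge0; [exact: exp_weight_ge0|move=> r r0; rewrite invr_gt0 Vn_gt0].
Qed.

Lemma MLeb_ge0 (f : Gn R n -> R) p : (0 <= MLeb f p)%E.
Proof. by rewrite MLebE; apply: dil_max_ge0 => // r r0; rewrite invr_gt0. Qed.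

Lemma Mdil_above (f : Gn R n -> R) (l : R) p : measurable_fun setT f -> 0 <= l ->
  (Mdil f p <= Mdil (above l f) p + l%:E)%E.
Proof.
rewrite !MdilE; apply: dil_max_above.
- exact: exp_weight_ge0.
- exact: measurable_exp_weight.
- by move=> r r0; rewrite invr_gt0 Vn_gt0.
- exact: Vn_avg.
Qed.
End MLeb_Mdil.

(** * Weak type (1,1) on a slice, from Hardy-Littlewood *)

Section weak_type.
Context {R : realType} (n : nat) (n1 : (1 <= n)%N).
Notation leb := (@lebesgue_measure R).
Variables (f : Gn R n -> R) (mf : measurable_fun setT f).
Let n0 : 0 < n%:R :> R. Proof. by rewrite ltr0n. Qed.
Let nN0 : - n%:R != 0 :> R. Proof. by rewrite oppr_eq0 gt_eqF. Qed.

(** The slice f (x, .) in the coordinate v = y^(-n).  In this coordinate the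
    measure dy / y^(n+1) is Lebesgue measure up to the factor n, and Mdil becomes
    a one-sided maximal operator of the half-line: that is the exact sense in
    which its weight is compatible with the Haar measure. *)
Definition half_line_profile (x : Rn R n) (v : R) : R :=
  if 0 < v then f (x, Rexp (ln v / - n%:R)) else 0.

Lemma measurable_half_line_profile x : measurable_fun setT (half_line_profile x).
Proof.
apply: measurable_fun_ifT => //; first exact: measurable_fun_ltr.
apply: measurableT_comp => //.
apply: (measurableT_comp (measurable_pair1 x)).
apply: (measurableT_comp measurable_Rexp).
by apply: measurable_funM => //; exact: measurable_ln.
Qed.

Lemma half_line_profileE x (s : R) :
  half_line_profile x (expR (- n%:R * s)) = f (x, Rexp s).
Proof. by rewrite /half_line_profile expR_gt0 expRK mulrAC divff// mul1r. Qed.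

Let mF := measurable_half_line_profile.

(** Write w = e^(-ns).  As t runs over [0, r[, the point w e^(-nt) runs over an
    interval with right end w and length rho = w (1 - e^(-nr)), which is half of
    the ball of center w and radius rho; since V_n(r) = rho / (n w), the average
    over the ball loses only the factor 2. *)
Lemma dil_avg_HL (x : Rn R n) (s r : R) : 0 < r ->
  (dil_avg (fun r => ((Vn n r)^-1)%R) (@exp_weight R n) f r (x, Rexp s) <=
   2%:E * HL_maximal (half_line_profile x) (expR (- n%:R * s)%R))%E.
Proof.
move=> r0; set F := half_line_profile x; set w := expR _.
have w0 : 0 < w by exact: expR_gt0.
have wn0 : 0 < w * n%:R by rewrite mulr_gt0.
pose rho := w * (1 - expR (- n%:R * r)).
have e1 : 0 < 1 - expR (- n%:R * r).
  by rewrite subr_gt0 -[ltRHS]expR0 ltr_expR mulNr oppr_lt0 mulr_gt0.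
have rho0 : 0 < rho by rewrite mulr_gt0.
set I := (\int[leb]_(t in `[0%R, r]) (`|f (dil t (x, Rexp s))| * exp_weight n t)%:E)%E.
have mI : measurable (`[0, r[%classic : set (measurableTypeR R)) by exact: measurable_itv.
have mB : measurable (ball w rho : set (measurableTypeR R)) by exact: measurable_ball.
have mabsF : measurable_fun setT (fun v => `|F v|%:E).
  by apply/measurable_EFinP; apply: measurableT_comp => //; exact: mF.
have Ige0 : (0 <= I)%E.
  by apply: integral_ge0 => t _; rewrite lee_fin mulr_ge0// exp_weight_ge0.
(* Both integrals become one over the half-line by v = w e^(-nt); on the left
   v stays in the ball. *)
have key : ((w * n%:R)%:E * I <= \int[leb]_(v in ball w rho) `|F v|%:E)%E.
  have mdil := measurable_dil_slice (@measurable_exp_weight R n) mf (x, Rexp s).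
  rewrite /I -integral_itv_bndo_bndc; last exact: measurable_funTS.
  rewrite -ge0_integralZl//; last 3 first.
  - exact: measurable_funTS.
  - by move=> t _; rewrite lee_fin mulr_ge0// exp_weight_ge0.
  - by rewrite lee_fin ltW.
  pose g := (fun v => `|F v|%:E) \_ (ball w rho).
  have mg : measurable_fun setT g.
    by apply/(measurable_restrictT _ _).1 => //; exact: measurable_funTS.
  have g0 v : (0 <= g v)%E by apply: erestrict_ge0.
  rewrite [leRHS]integral_mkcond -/g.
  apply: (@le_trans _ _ (\int[leb]_(v in `]0%R, +oo[) g v)%E); last first.
    by apply: ge0_subset_integral.
  rewrite (exp_substitution w0 nN0)// [leLHS]integral_mkcond.
  have we t : w * expR (- n%:R * t) = expR (- n%:R * (s + t)).
    by rewrite mulrDr expRD.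
  apply: ge0_le_integral => //.
  - move=> t _; apply: erestrict_ge0 => // {}t _.
    by rewrite mule_ge0 ?lee_fin ?(ltW wn0)// mulr_ge0// exp_weight_ge0.
  - apply/(measurable_restrictT _ _).1 => //; apply: measurable_funTS.
    exact: measurable_funeM.
  - apply: emeasurable_funM; last first.
      apply/measurable_EFinP. exact: (measurable_exp_scaled (w * `|- n%:R|) (- n%:R)).
    exact: (measurableT_comp mg (measurable_exp_scaled w (- n%:R))).
  move=> t _; rewrite patchE; case: ifPn => [|_]; last first.
    by rewrite mule_ge0// lee_fin !mulr_ge0 ?expR_ge0// ltW.
  rewrite inE/= in_itv/= => /andP[t0 tr].
  rewrite /g patchE ifT; last first.
    rewrite inE /ball/= -{1}(mulr1 w) -mulrBr ger0_norm.
      by rewrite ltr_pM2l// ltrD2l ltrN2 ltr_expR ltr_nM2l// oppr_lt0.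
    rewrite mulr_ge0 ?subr_ge0 ?(ltW w0)// -[leRHS]expR0 ler_expR.
    by rewrite mulNr oppr_le0 mulr_ge0// ltW.
  rewrite we /F half_line_profileE dil_Rexp -!EFinM lee_fin normrN (ger0_norm (ltW n0)).
  by rewrite /exp_weight -mulNr [leLHS]mulrCA.
have Vn0 := Vn_gt0 n1 r0.
apply: (@le_trans _ _ (2%:E * iavg F (ball w rho))%E); last first.
  apply: lee_wpmul2l => //; apply: ereal_sup_ubound; exists rho => //.
  by rewrite /= in_itv/= andbT.
rewrite /iavg lebesgue_measure_ball ?(ltW rho0)// inver mulrn_eq0/= gt_eqF//.
rewrite /dil_avg -/I.
apply: (@le_trans _ _ (2%:E * ((rho *+ 2)^-1%:E * ((w * n%:R)%:E * I)))%E); last first.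
  by apply: lee_wpmul2l => //; apply: lee_wpmul2l => //; rewrite lee_fin invr_ge0 mulrn_wge0// ltW.
rewrite !muleA -!EFinM le_eqVlt; apply/orP; left; apply/eqP; congr (_%:E * _)%E.
rewrite VnE// /rho -mulNr; field.
by rewrite !gt_eqF.
Qed.

Lemma Mdil_HL (x : Rn R n) (s : R) :
  (Mdil f (x, Rexp s) <=
   2%:E * HL_maximal (half_line_profile x) (expR (- n%:R * s)%R))%E.
Proof. by apply: ge_ereal_sup => _ [r /= r0 <-]; exact: dil_avg_HL. Qed.

Lemma integral_half_line_profile (x : Rn R n) :
  (\int[leb]_v `|half_line_profile x v|%:E =
   n%:R%:E * \int[haar_Rpos n]_y `|f (x, y)|%:E)%E.
Proof.
have mEF : measurable_fun setT (fun v => `|half_line_profile x v|%:E).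
  by apply/measurable_EFinP; apply: measurableT_comp => //; exact: mF.
have mfx : measurable_fun setT (fun y => `|f (x, y)|%:E).
  apply/measurable_EFinP; apply: measurableT_comp => //.
  exact: (measurableT_comp mf (measurable_pair1 x)).
rewrite integral_haar_Rpos//.
have mexp : measurable_fun setT (fun s => (`|f (x, Rexp s)|%:E * (expR (- (n%:R * s)))%:E)%E).
  apply: emeasurable_funM; last by apply/measurable_EFinP; exact: (@measurable_exp_weight R n).
  exact: (measurableT_comp mfx measurable_Rexp).
rewrite -ge0_integralZl//.
transitivity (\int[leb]_(v in `]0%R, +oo[) `|half_line_profile x v|%:E)%E.
  rewrite [RHS]integral_mkcond; apply: eq_integral => v _.
  rewrite patchE; case: ifPn => //; rewrite notin_setE/= in_itv/= andbT => /negP.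
  by rewrite /half_line_profile => /negbTE ->; rewrite normr0.
apply: etrans.
  by apply: (@exp_substitution R 1 (- n%:R) ltr01 nN0 _ mEF).
apply: eq_integral => s _.
rewrite !mul1r half_line_profileE normrN (ger0_norm (ltW n0)) mulNr.
by rewrite muleCA -EFinM.
Qed.

(** The constant is 2 (one-sided against centered intervals) times 3 (the
    constant of the Hardy-Littlewood maximal inequality); the factors n of the
    change of variables v = y^(-n) cancel. *)
Lemma Mdil_weak_slice (x : Rn R n) (l : R) : 0 < l ->
  (haar_Rpos n [set y | l%:E < Mdil f (x, y)] <=
   (6 / l)%:E * \int[haar_Rpos n]_y `|f (x, y)|%:E)%E.
Proof.
move=> l0; set F := half_line_profile x.
set J := (\int[haar_Rpos n]_y `|f (x, y)|%:E)%E.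
have J0 : (0 <= J)%E by exact: integral_ge0.
have [->|Joo] := eqVneq J +oo%E.
  by rewrite gt0_muley ?leey// lte_fin divr_gt0.
have iF : locally_integrable setT F.
  apply: open_integrable_locally; first exact: openT.
  apply/integrableP; split; first by apply/measurable_EFinP; exact: (mF x).
  rewrite (_ : (\int[_]_(_ in _) _)%E = (n%:R%:E * J)%E); last first.
    by rewrite -integral_half_line_profile.
  by rewrite lte_mul_pinfty// ?lee_fin ?ltW// ltey.
pose H := [set v : R | (l / 2)%:E < HL_maximal F v]%E.
have mH : measurable H.
  rewrite -[X in measurable X]setTI; apply: emeasurable_fun_o_infty => //.
  exact: measurable_HL_maximal.
pose E := [set y | l%:E < Mdil f (x, y)]%E.
have mE : measurable E.
  rewrite -[X in measurable X]setTI; apply: emeasurable_fun_o_infty => //.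
  exact: (measurableT_comp (measurable_Mdil n1 mf) (measurable_pair1 x)).
rewrite -/E -[X in haar_Rpos _ X]setIT -(integral_indic _ measurableT mE).
rewrite integral_haar_Rpos//; last exact/measurable_EFinP.
have HE s : Rexp s \in E -> expR (- n%:R * s) \in H.
  rewrite !inE /E /H /= => lM; have := lt_le_trans lM (Mdil_HL x s).
  by rewrite -lte_pdivrMl// -EFinM mulrC.
have mEH : measurable_fun setT (fun v : R => (\1_H v)%:E : \bar R).
  exact/measurable_EFinP.
have mG : measurable_fun setT (fun s : R => ((\1_H (1 * expR (- n%:R * s)))%:E *
    (1 * `|- n%:R| * expR (- n%:R * s))%:E)%E).
  apply: emeasurable_funM.
    exact: (measurableT_comp mEH (measurable_exp_scaled 1 (- n%:R))).
  by apply/measurable_EFinP; exact: (measurable_exp_scaled (1 * `|- n%:R|) (- n%:R)).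
apply: (@le_trans _ _ (\int[leb]_s ((n%:R^-1)%:E *
  ((\1_H (1 * expR (- n%:R * s)))%:E * (1 * `|- n%:R| * expR (- n%:R * s))%:E)))%E).
  apply: ge0_le_integral => //.
  - apply: emeasurable_funM; last by apply/measurable_EFinP; exact: (@measurable_exp_weight R n).
    by apply/measurable_EFinP; apply: measurableT_comp => //; exact: measurable_Rexp.
  - exact: measurable_funeM.
  move=> s _; rewrite -!EFinM lee_fin !mul1r normrN (ger0_norm (ltW n0)).
  rewrite mulrCA mulKf ?gt_eqF// mulNr ler_wpM2r ?expR_ge0// -mulNr !indicE ler_nat.
  by case: (boolP (Rexp s \in E)) => // /HE ->.
rewrite ge0_integralZl//.
rewrite -[X in (_ * X <= _)%E](@exp_substitution R 1 (- n%:R) ltr01 nN0 _ mEH)//.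
rewrite integral_indic//.
apply: (@le_trans _ _ ((n%:R^-1)%:E * leb H)%E).
  apply: lee_wpmul2l; first by rewrite lee_fin invr_ge0 ltW.
  by apply: le_measure; rewrite ?inE//; exact: measurableI.
apply: (@le_trans _ _ ((n%:R^-1)%:E * ((3 / (l / 2))%:E * (n%:R%:E * J)))%E).
  apply: lee_wpmul2l; first by rewrite lee_fin invr_ge0 ltW.
  rewrite -integral_half_line_profile; apply: maximal_inequality => //.
  by rewrite divr_gt0.
rewrite !muleA -!EFinM le_eqVlt; apply/orP; left; apply/eqP; congr (_%:E * _)%E.
by field; rewrite !gt_eqF.
Qed.

End weak_type.

(** * Marcinkiewicz interpolation *)

Section layer_cake.
Context {R : realType}.
Notation leb := (@lebesgue_measure R).
Local Open Scope ereal_scope.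

Lemma measurable_below (b : \bar R) : measurable [set v : R | v%:E < b].
Proof.
rewrite -[X in measurable X]setTI -[X in _ `&` X]/[set v : R | EFin v < b].
exact: emeasurable_fun_infty_o.
Qed.

Lemma lebesgue_measure_below (b : \bar R) : 0 <= b ->
  leb ([set v : R | v%:E < b] `&` `]0%R, +oo[) = b.
Proof.
case: b => [r r0| _|//].
  rewrite (_ : _ `&` _ = `]0%R, r[%classic); last first.
    apply/seteqP; split => v /=; rewrite !in_itv/= ?andbT lte_fin.
      by move=> [-> ->].
    by move=> /andP[-> ->].
  rewrite lebesgue_measure_itv/= lte_fin; case: ltP => h; first by rewrite oppr0 adde0.
  by apply/eqP; rewrite eq_le r0 lee_fin.
rewrite (_ : _ `&` _ = `]0%R, +oo[%classic); last first.
  by apply/seteqP; split => v /=; [case|rewrite ltry].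
by rewrite lebesgue_measure_itv/= ltry.
Qed.

(** The layer cake formula with heights parametrized as e^t: the usual
    integral of q l^(q-1) over l < b, after l = e^t.  This form has no
    singularity at l = 0, even for q < 1. *)
Lemma poweR_layer_cake (b : \bar R) (q : R) : 0 <= b -> (0 < q)%R ->
  b `^ q = \int[leb]_t ((\1_[set t : R | ((expR t)%:E < b)%E] t)%:E *
                        (q * expR (q * t))%:E).
Proof.
move=> b0 q0; rewrite -[LHS]lebesgue_measure_below ?poweR_ge0//.
set S := [set v : R | _]; have mS : measurable S by exact: measurable_below.
have mI : measurable (`]0%R, +oo[%classic : set (measurableTypeR R)).
  exact: measurable_itv.
transitivity (\int[leb]_(v in `]0%R, +oo[) (\1_S v)%:E); first by rewrite integral_indic.
have mES : measurable_fun setT (fun v : R => (\1_S v)%:E : \bar R) by exact/measurable_EFinP.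
apply: etrans.
  by apply: (@exp_substitution R 1 q ltr01 _ _ mES) => //; rewrite gt_eqF.
apply: eq_integral => t _; rewrite !mul1r (gtr0_norm q0); congr (_%:E * _).
rewrite !indicE; congr ((nat_of_bool _)%:R); apply/idP/idP; rewrite !inE /S /=.
  move: b0; case: b {S mS mES} => [r|_ _|//]; rewrite ?ltry// poweR_EFin !lte_fin lee_fin.
  move=> r0; rewrite (_ : expR (q * t) = (expR t) `^ q)%R; last first.
    by rewrite /powR gt_eqF ?expR_gt0// expRK.
  apply: contraTT; rewrite -!leNgt => rt.
  by apply: ge0_ler_powR; rewrite ?nnegrE ?expR_ge0// ltW.
move: b0; case: b {S mS mES} => [r|_ _|//]; last by rewrite poweRyr ?gt_eqF// ltry.
rewrite poweR_EFin !lte_fin lee_fin => r0 tr.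
rewrite (_ : expR (q * t) = (expR t) `^ q)%R; last first.
  by rewrite /powR gt_eqF ?expR_gt0// expRK.
by apply: gt0_ltr_powR; rewrite ?nnegrE ?expR_ge0.
Qed.
End layer_cake.

Section marcinkiewicz.
Context {d} {T : measurableType d} {R : realType}.
Variables (mu : {sigma_finite_measure set T -> \bar R}) (C : R).
Variable M : (T -> R) -> T -> \bar R.
Notation leb := (@lebesgue_measure R).
Local Open Scope ereal_scope.
Hypothesis C0 : (0 <= C)%R.
Hypothesis M_ge0 : forall f x, 0 <= M f x.
Hypothesis measurable_M : forall f,
  measurable_fun setT f -> measurable_fun setT (M f).
Hypothesis M_weak : forall f, measurable_fun setT f -> forall l : R, (0 < l)%R ->
  mu [set x | l%:E < M f x] <= (C / l)%:E * \int[mu]_x `|f x|%:E.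
Hypothesis M_above : forall f l x, measurable_fun setT f -> (0 <= l)%R ->
  M f x <= M (above l f) x + l%:E.

Variables (f : T -> R) (mf : measurable_fun setT f).

(** If M f > l + e then M (above l f) > e: the weak bound at height e is applied
    to the large part of f only. *)
Lemma above_weak (l e : R) : (0 <= l)%R -> (0 < e)%R ->
  mu [set x | (l + e)%:E < M f x] <=
  (C / e)%:E * \int[mu]_x `|above l f x|%:E.
Proof.
move=> l0 e0; apply: le_trans (M_weak (measurable_above l mf) e0).
have mset g (a : R) : measurable_fun setT g -> measurable [set x | a%:E < M g x].
  move=> mg; rewrite -[X in measurable X]setTI.
  by apply: emeasurable_fun_o_infty => //; exact: measurable_M.
apply: le_measure; rewrite ?inE.
- exact: mset.
- by apply: mset; exact: measurable_above.
move=> x /= le; have := lt_le_trans le (M_above x mf l0).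
by rewrite EFinD [in X in X -> _]addeC lteD2rE.
Qed.

(** The large part of f above an essential bound l vanishes almost everywhere,
    so its weak bound is 0 and M f exceeds l + 1/(k+1) only on a null set. *)
Lemma strong_type_oo (l : R) : (0 <= l)%R ->
  {ae mu, forall x, `|f x|%:E <= l%:E} -> {ae mu, forall x, M f x <= l%:E}.
Proof.
move=> l0 fl.
pose A k := [set x | (l + k.+1%:R^-1)%:E < M f x].
have mA k : measurable (A k).
  rewrite -[X in measurable X]setTI.
  by apply: emeasurable_fun_o_infty => //; exact: measurable_M.
have A0 k : mu (A k) = 0.
  apply/eqP; rewrite eq_le measure_ge0 andbT.
  apply: (le_trans (above_weak l0 _)); first by rewrite invr_gt0.
  rewrite (_ : \int[mu]_x _ = 0) ?mule0//.
  rewrite (ae_eq_integral (cst 0))//.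
  - by rewrite integral0.
  - by apply/measurable_EFinP; apply: measurableT_comp => //; exact: measurable_above.
  - apply: filterS fl => x /= + _; rewrite lee_fin /above leNgt => /negbTE ->.
    by rewrite normr0.
have : mu.-negligible (\bigcup_k A k).
  by apply: negligible_bigcup => k; exists (A k); split; [exact: mA|exact: A0|].
apply: negligibleS => x /= /negP; rewrite -ltNge => lM.
have [k lk] : exists k, (l + k.+1%:R^-1)%:E < M f x.
  move: lM; case: (M f x) => [r|_|//]; last by exists 0%N; rewrite ltry.
  rewrite lte_fin => lr; have rl0 : (0 < r - l)%R by rewrite subr_gt0.
  exists (Num.truncn (r - l)^-1); rewrite lte_fin -ltrBrDl.
  by rewrite invf_plt ?posrE//; apply: truncnS_gt.
by exists k.
Qed.

Variables (p : R) (p1 : (1 < p)%R).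
Let p0 : (0 < p)%R. Proof. exact: lt_trans p1. Qed.
Let pm0 : (0 < p - 1)%R. Proof. by rewrite subr_gt0. Qed.

Let K1 : R := (2 * C * p / (p - 1))%R.
Let K1_ge0 : (0 <= K1)%R.
Proof. by rewrite /K1 divr_ge0 ?(ltW pm0)// mulr_ge0 ?(ltW p0)// mulr_ge0. Qed.

(* A and B are the layer cake integrands of (M f)^p and of the multiple
   K1 |f| (2 |f|)^(p-1) of |f|^p. *)
Let A (x : T) (t : R) := (\1_[set t : R | ((expR t)%:E < M f x)%E] t)%:E * (p * expR (p * t))%:E.
Let B (x : T) (t : R) := (K1 * `|f x|)%:E *
  ((\1_[set t : R | ((expR t)%:E < (2 * `|f x|)%:E)%E] t)%:E * ((p - 1) * expR ((p - 1) * t))%:E).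

Let mexp (q : R) : measurable_fun setT (fun z : T * measurableTypeR R => (q * expR (q * z.2))%:E).
Proof.
apply/measurable_EFinP; apply: (measurableT_comp (measurable_exp_scaled q q)).
exact: measurable_snd.
Qed.

Let mlayer (h : T -> \bar R) : measurable_fun setT h ->
  measurable_fun setT (fun z : T * measurableTypeR R =>
    (\1_[set t : R | ((expR t)%:E < h z.1)%E] z.2)%:E : \bar R).
Proof.
move=> mh; apply/measurable_EFinP.
rewrite (_ : (fun _ => _) =
    \1_[set z : T * measurableTypeR R | ((expR z.2)%:E < h z.1)%E]); last first.
  by apply/funext => z; rewrite !indicE; congr ((nat_of_bool _)%:R); apply/idP/idP; rewrite !inE.
apply: measurable_indic; rewrite -[X in measurable X]setTI.
apply: emeasurable_fun_lt => //.
- apply/measurable_EFinP; apply: (measurableT_comp (@measurable_expR R)).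
  exact: measurable_snd.
- by apply: measurableT_comp => //; exact: measurable_fst.
Qed.

Let A_ge0 z : 0 <= A z.1 z.2.
Proof. by rewrite mule_ge0 ?lee_fin// mulr_ge0 ?expR_ge0// ltW. Qed.
Let B_ge0 z : 0 <= B z.1 z.2.
Proof.
apply: mule_ge0; rewrite lee_fin; first exact: mulr_ge0.
by rewrite mulr_ge0 ?mulr_ge0 ?expR_ge0 ?(ltW pm0).
Qed.

Let measurable_A : measurable_fun setT (fun z : T * measurableTypeR R => A z.1 z.2).
Proof. by apply: emeasurable_funM; [apply: mlayer; exact: measurable_M|exact: mexp]. Qed.

Let measurable_2f : measurable_fun setT (fun x => (2 * `|f x|)%:E).
Proof. by apply/measurable_EFinP; apply: measurable_funM => //; exact: measurableT_comp. Qed.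

Let measurable_B : measurable_fun setT (fun z : T * measurableTypeR R => B z.1 z.2).
Proof.
apply: emeasurable_funM.
  apply/measurable_EFinP; apply: measurable_funM => //; apply: measurableT_comp => //.
  by apply: measurableT_comp => //; exact: measurable_fst.
by apply: emeasurable_funM; [exact: (mlayer measurable_2f)|exact: mexp].
Qed.

(* Halving the height e^t leaves e^t / 2 for the truncation and e^t / 2 for the
   weak bound; the factor 1 / (e^t / 2) of the latter lowers the exponent of e^t
   from p to p - 1. *)
Let slice_le t : \int[mu]_x A x t <= \int[mu]_x B x t.
Proof.
pose l := (expR t / 2)%R; have l0 : (0 < l)%R by rewrite divr_gt0// expR_gt0.
have e0 : (0 <= p * expR (p * t))%R by rewrite mulr_ge0 ?expR_ge0// ltW.
have mS : measurable [set x | (expR t)%:E < M f x].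
  rewrite -[X in measurable X]setTI.
  by apply: emeasurable_fun_o_infty => //; exact: measurable_M.
have -> : \int[mu]_x A x t = (p * expR (p * t))%:E * mu [set x | (l + l)%:E < M f x].
  rewrite (_ : [set x | _] = [set x | (expR t)%:E < M f x]); last first.
    by apply/seteqP; split => x /=; rewrite /l -splitr.
  rewrite -[X in mu X]setIT -(integral_indic _ measurableT mS) -ge0_integralZl//; last first.
    exact/measurable_EFinP.
  by apply: eq_integral => x _; rewrite /A muleC; congr (_ * _).
apply: (@le_trans _ _ ((p * expR (p * t))%:E * ((C / l)%:E * \int[mu]_x `|above l f x|%:E))).
  by apply: lee_wpmul2l => //; apply: above_weak => //; exact: ltW.
rewrite muleA -EFinM -ge0_integralZl//; last 2 first.
- by apply/measurable_EFinP; apply: measurableT_comp => //; exact: measurable_above.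
- by rewrite lee_fin mulr_ge0// divr_ge0// ltW.
rewrite le_eqVlt; apply/orP; left; apply/eqP; apply: eq_integral => x _.
rewrite /B /above indicE (_ : (t \in _) = (l < `|f x|)%R); last first.
  rewrite /l ltr_pdivrMr// mulrC.
  by apply/idP/idP; rewrite inE/= lte_fin.
case: ifPn => _; last by rewrite normr0 mul0e !mule0.
rewrite mul1e -!EFinM; congr EFin.
have -> : (expR ((p - 1) * t) = expR (p * t) / expR t)%R by rewrite mulrBl mul1r expRD expRN.
rewrite /K1 /l; field.
by rewrite !gt_eqF ?expR_gt0.
Qed.

(** The Marcinkiewicz interpolation argument between the weak bound at p = 1 and
    the trivial bound at infinity: integrate slice_le in t and exchange the
    integrals.  The condition p > 1 is what makes the inner t-integral of B
    finite. *)
Lemma marcinkiewicz :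
  \int[mu]_x (M f x `^ p) <= (K1 * 2 `^ (p - 1))%:E * \int[mu]_x (`|f x|%:E `^ p).
Proof.
under eq_integral do rewrite (poweR_layer_cake (M_ge0 _ _) p0).
have -> : \int[mu]_x \int[leb]_t A x t = \int[leb]_t \int[mu]_x A x t.
  exact: (fubini_tonelli (fun z : T * measurableTypeR R => A z.1 z.2) measurable_A A_ge0).
apply: (@le_trans _ _ (\int[leb]_t \int[mu]_x B x t)).
  apply: ge0_le_integral => //.
  - by move=> t _; apply: integral_ge0 => x _; exact: (A_ge0 (x, t)).
  - exact: (measurable_fun_fubini_tonelli_G (fun z : T * measurableTypeR R => A z.1 z.2)).
  - exact: (measurable_fun_fubini_tonelli_G (fun z : T * measurableTypeR R => B z.1 z.2)).
have <- : \int[mu]_x \int[leb]_t B x t = \int[leb]_t \int[mu]_x B x t.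
  exact: (fubini_tonelli (fun z : T * measurableTypeR R => B z.1 z.2) measurable_B B_ge0).
rewrite -ge0_integralZl//; last 3 first.
- apply: (measurableT_comp (measurable_poweR _)).
  by apply/measurable_EFinP; exact: measurableT_comp.
- by move=> x _; exact: poweR_ge0.
- by rewrite lee_fin mulr_ge0// powR_ge0.
rewrite le_eqVlt; apply/orP; left; apply/eqP; apply: eq_integral => x _ /=.
rewrite /B ge0_integralZl//; last 3 first.
- apply: emeasurable_funM.
    exact: (measurableT_comp (mlayer measurable_2f) (measurable_pair1 x)).
  exact: (measurableT_comp (mexp _) (measurable_pair1 x)).
- by move=> t _; rewrite mule_ge0 ?lee_fin ?mulr_ge0 ?expR_ge0 ?(ltW pm0).
- by rewrite lee_fin mulr_ge0.
rewrite -poweR_layer_cake//.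
rewrite !poweR_EFin -!EFinM; congr EFin.
rewrite powRM// -(mulr_powRB1 (normr_ge0 (f x)) p0); ring.
Qed.

End marcinkiewicz.

(** * Bounds for the Haar-compatible operator *)

Section Mdil_bounds.
Context {R : realType} (n : nat) (n1 : (1 <= n)%N).
Notation leb := (@lebesgue_measure R).
Local Open Scope ereal_scope.

Lemma Lfun_measurable (p : \bar R) (f : Gn R n -> R) :
  f \in Lfun (haar n) p -> measurable_fun setT f.
Proof. by move=> /sub_Lfun_mfun/set_mem. Qed.

(** Both sides are integrals over x of their counterparts on the slices. *)
Lemma Mdil_weak (f : Gn R n -> R) : measurable_fun setT f ->
  forall l : R, (0 < l)%R ->
  haar n [set p | l%:E < Mdil f p] <= (6 / l)%:E * \int[haar n]_p `|f p|%:E.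
Proof.
move=> mf l l0; set A := [set p | _].
have mA : measurable A.
  rewrite -[X in measurable X]setTI; apply: emeasurable_fun_o_infty => //.
  exact: measurable_Mdil.
have mabs : measurable_fun setT (fun p => `|f p|%:E).
  by apply/measurable_EFinP; exact: measurableT_comp.
rewrite -[X in haar _ X]setIT -(integral_indic _ measurableT mA).
rewrite fubini_tonelli1//; last exact/measurable_EFinP.
rewrite fubini_tonelli1// -ge0_integralZl//; last 3 first.
- exact: measurable_fun_fubini_tonelli_F.
- by move=> x _; apply: integral_ge0.
- by rewrite lee_fin divr_ge0// ltW.
apply: ge0_le_integral => //.
- by move=> x _; apply: integral_ge0 => y _; rewrite lee_fin.
- by apply: measurable_fun_fubini_tonelli_F => //; exact/measurable_EFinP.
- by apply: measurable_funeM; exact: measurable_fun_fubini_tonelli_F.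
move=> x _; apply: le_trans (Mdil_weak_slice n1 mf x l0).
set Ax := [set y | _]; have mAx : measurable Ax.
  rewrite -[X in measurable X]setTI.
  exact: (measurable_pair1 x measurableT mA).
by rewrite -[X in _ <= haar_Rpos _ X]setIT -(integral_indic _ measurableT mAx).
Qed.

Lemma Mdil_weak_type11 : weak_type11 (@Mdil R n).
Proof.
exists 6%R => f fL l l0; rewrite Lnorm1.
exact: (Mdil_weak (Lfun_measurable fL)).
Qed.

Lemma Mdil_Lp_bounded (p : R) : (1 < p)%R -> Lp_bounded p%:E (@Mdil R n).
Proof.
move=> p1; have p0 : (0 < p)%R by exact: lt_trans p1.
pose K : R := (2 * 6 * p / (p - 1) * 2 `^ (p - 1))%R.
have K0 : (0 <= K)%R.
  by rewrite mulr_ge0 ?powR_ge0// divr_ge0 ?subr_ge0 ?mulr_ge0 ?ltW.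
exists (K `^ p^-1)%R => f fL; have mf := Lfun_measurable fL.
rewrite unlock -poweR_EFin -poweRM ?lee_fin//; last first.
  by apply: integral_ge0 => x _; exact: poweR_ge0.
apply: gt0_ler_poweR.
- by rewrite invr_ge0 ltW.
- by rewrite in_itv/= leey andbT; apply: integral_ge0 => x _; exact: poweR_ge0.
- rewrite in_itv/= leey andbT mule_ge0 ?lee_fin//.
  by apply: integral_ge0 => x _; rewrite lee_fin powR_ge0.
under eq_integral do rewrite gee0_abs ?Mdil_ge0//.
apply: (@marcinkiewicz _ _ _ (sigma_finite_haar n) 6%R (@Mdil R n)) => //.
- by move=> g x; exact: Mdil_ge0.
- by move=> g; exact: measurable_Mdil.
- exact: Mdil_weak.
- by move=> g l x; exact: Mdil_above.
Qed.

Lemma Mdil_Loo_bounded : Lp_bounded +oo (@Mdil R n).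
Proof.
exists 1%R => f fL; have mf := Lfun_measurable fL; rewrite mul1e.
have : 'N[haar n]_+oo[EFin \o f] < +oo.
  exact: (set_mem (sub_Lfun_finLfun fL)).
have := Lnorm_ge0 (haar n) +oo (EFin \o f).
rewrite unlock /=; case: ifPn => // _.
set L := ess_sup _ _ => L0 Loo.
have Lfin : L \is a fin_num by rewrite ge0_fin_numE.
apply/ess_supP.
have := ess_sup_ge (haar n) (abse \o (EFin \o f)); rewrite -/L -(fineK Lfin) => fL'.
have : {ae haar n, forall x, Mdil f x <= (fine L)%:E}.
  apply: (@strong_type_oo _ _ _ (sigma_finite_haar n) 6%R (@Mdil R n)) => //.
  - by move=> g; exact: measurable_Mdil.
  - exact: Mdil_weak.
  - by move=> g l x; exact: Mdil_above.
  - exact: fine_ge0.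
by apply: filterS => x /=; rewrite gee0_abs// Mdil_ge0.
Qed.
End Mdil_bounds.

(** * The indicator of a box *)

Section counterexample.
Context {R : realType} (n : nat) (n1 : (1 <= n)%N).
Notation leb := (@lebesgue_measure R).
Let n0 : 0 < n%:R :> R. Proof. by rewrite ltr0n. Qed.

Definition unit_cube : set (Rn R n) :=
  [set x | forall i, (`[0, 1]%classic : set (measurableTypeR R)) (tnth x i)].

(** In the coordinate s = ln y. *)
Definition log_interval (a b : R) : set (Rpos R) :=
  [set y | (`[a, b]%classic : set (measurableTypeR R)) (ln (Rpos_val y))].

Lemma measurable_unit_cube : measurable unit_cube.
Proof.
have mI : measurable (`[0, 1]%classic : set (measurableTypeR R)).
  exact: measurable_itv.
rewrite (_ : unit_cube = \bigcap_(i in [set: 'I_n]) ((fun v : Rn R n => tnth v i)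
    @^-1` (`[0, 1]%classic : set (measurableTypeR R)))).
  apply: fin_bigcap_measurable => [|i _]; first exact: finite_finset.
  by rewrite -[X in measurable X]setTI; exact: measurable_tnth.
by apply/seteqP; split => v Bv i; [move=> _; exact: Bv|exact: (Bv i Logic.I)].
Qed.

Lemma lebesgue_unit_cube : lebesgue_Rn n unit_cube = 1%E.
Proof.
apply: (etrans (@lebesgue_Rn_box R n (fun=> `[0, 1]%classic) _)) => [i|].
  exact: measurable_itv.
by rewrite big1// => i _; rewrite lebesgue_measure_itv/= lte_fin ltr01 oppr0 adde0.
Qed.

Lemma measurable_log_interval a b : measurable (log_interval a b).
Proof.
rewrite -[X in measurable X]setTI.
by apply: (measurableT_comp (@measurable_ln R) measurable_Rpos_val) => //.
Qed.

Lemma log_interval_Rexp a b s : log_interval a b (Rexp s) <-> a <= s <= b.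
Proof. by rewrite /log_interval /= in_itv/= expRK. Qed.

Lemma haar_Rpos_log_interval a b : a <= b ->
  haar_Rpos n (log_interval a b) =
  (\int[leb]_(s in `[a, b]) (expR (- (n%:R * s)))%:E)%E.
Proof.
move=> ab; have mI := measurable_log_interval a b.
rewrite -[X in haar_Rpos _ X]setIT -(integral_indic _ measurableT mI).
rewrite integral_haar_Rpos//; last exact/measurable_EFinP.
rewrite [RHS]integral_mkcond; apply: eq_integral => s _.
rewrite patchE indicE (_ : (Rexp s \in _) = (s \in `[a, b]%classic)).
  by case: ifPn; rewrite ?mul1e ?mul0e.
by apply/idP/idP; rewrite !inE/= in_itv/= => /log_interval_Rexp.
Qed.

Lemma haar_Rpos_log_interval_bounds a b : a < b ->
  (((b - a) * expR (- (n%:R * b)))%:E <= haar_Rpos n (log_interval a b) <=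
   ((b - a) * expR (- (n%:R * a)))%:E)%E.
Proof.
move=> ab; rewrite haar_Rpos_log_interval ?(ltW ab)//.
have mI : measurable (`[a, b]%classic : set (measurableTypeR R)) by exact: measurable_itv.
have me : measurable_fun (`[a, b]%classic : set (measurableTypeR R))
    (fun s => (expR (- (n%:R * s)))%:E).
  by apply: measurable_funTS; apply/measurable_EFinP; exact: (measurable_exp_weight n).
have cstE (k : R) : (\int[leb]_(s in `[a, b]) k%:E = ((b - a) * k)%:E)%E.
  transitivity (k%:E * leb `[a, b])%E; first exact: integral_cst.
  by rewrite lebesgue_measure_itv/= lte_fin ab -EFinB -EFinM mulrC.
rewrite -!cstE; apply/andP; split; apply: ge0_le_integral => //.
- move=> s /=; rewrite in_itv/= => /andP[_ sb].
  by rewrite lee_fin ler_expR lerN2 ler_pM2l.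
- move=> s /=; rewrite in_itv/= => /andP[sa _].
  by rewrite lee_fin ler_expR lerN2 ler_pM2l.
Qed.

(** The indicator of this set, [0, 1]^n times [1, e], is the counterexample to
    all the negative statements. *)
Definition test_set : set (Gn R n) := unit_cube `*` log_interval 0 1.

Lemma measurable_test_set : measurable test_set.
Proof.
by apply: measurableX; [exact: measurable_unit_cube|exact: measurable_log_interval].
Qed.

Lemma haar_test_set : (haar n test_set < +oo)%E.
Proof.
rewrite haar_setX ?lebesgue_unit_cube ?mul1e; last 2 first.
- exact: measurable_unit_cube.
- exact: measurable_log_interval.
have /andP[_ h] := haar_Rpos_log_interval_bounds (@ltr01 R).
by apply: le_lt_trans h _; rewrite ltry.
Qed.

Definition test_fun : Gn R n -> R := \1_test_set.

Lemma measurable_test_fun : measurable_fun setT test_fun.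
Proof. by apply: measurable_indic; exact: measurable_test_set. Qed.

Lemma Lnorm_test_fun (p : R) : 1 <= p ->
  ('N[haar n]_p%:E[EFin \o test_fun] < +oo)%E.
Proof.
move=> p1; have p0 : p != 0 by rewrite gt_eqF// (lt_le_trans _ p1).
rewrite unlock; apply: poweR_lty.
rewrite (_ : (\int[_]_(_ in _) _)%E = haar n test_set); first exact: haar_test_set.
rewrite -[X in haar _ X]setIT -(integral_indic _ measurableT measurable_test_set).
apply: eq_integral => x _; rewrite /= /test_fun indicE.
by case: (x \in _); rewrite ?normr1 ?powR1// normr0 powR0.
Qed.

Lemma test_fun_Lfun (p : R) : 1 <= p -> test_fun \in Lfun (haar n) p%:E.
Proof.
move=> p1; apply/andP; split; rewrite inE/=.
  exact: measurable_test_fun.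
exact: Lnorm_test_fun.
Qed.

(** From the point (x, e^(-u)), dilations by e^t lie in the test set exactly for
    t in [u, u + 1]; the radius u + 1 is the first one that sees all of it. *)
Lemma dil_max_test_fun_ge (c w : R -> R) (x : Rn R n) (u : R) :
  (forall t, 0 <= w t) -> measurable_fun setT w -> (forall r, 0 < r -> 0 < c r) ->
  unit_cube x -> 0 <= u ->
  ((c (u + 1))%:E * \int[leb]_(t in `[u, (u + 1)%R]) (w t)%:E <=
   dil_max c w test_fun (x, Rexp (- u)))%E.
Proof.
move=> w0 mw c0 Qx u0; have r0 : 0 < u + 1 by rewrite ltr_wpDl.
apply: (@le_trans _ _ (dil_avg c w test_fun (u + 1) (x, Rexp (- u)))); last first.
  by apply: ereal_sup_ubound; exists (u + 1).
apply: lee_wpmul2l; first by rewrite lee_fin ltW// c0.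
have mI a b : measurable (`[a, b]%classic : set (measurableTypeR R)) by exact: measurable_itv.
apply: (@le_trans _ _ (\int[leb]_(t in `[u, (u + 1)%R])
    (`|test_fun (dil t (x, Rexp (- u)))| * w t)%:E)%E); last first.
  apply: ge0_subset_integral => //.
  - by apply: measurable_funTS; exact: (measurable_dil_slice mw measurable_test_fun).
  - by move=> t _; rewrite lee_fin mulr_ge0.
  - by apply: subset_itvr; rewrite bnd_simp.
rewrite le_eqVlt; apply/orP; left; apply/eqP; apply: eq_integral => t.
rewrite inE/= in_itv/= => /andP[ut tu]; rewrite dil_Rexp /test_fun indicE mem_set.
  by rewrite normr1 mul1r.
by split => //=; apply/log_interval_Rexp; rewrite addrC subr_ge0 ut lerBlDl.
Qed.

Lemma MLeb_test_fun_ge (x : Rn R n) (u : R) : unit_cube x -> 0 <= u ->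
  (((u + 1)^-1)%:E <= MLeb test_fun (x, Rexp (- u)))%E.
Proof.
move=> Qx u0; rewrite MLebE.
apply: le_trans (dil_max_test_fun_ge _ _ _ Qx u0) => //; last first.
  by move=> r r0; rewrite invr_gt0.
rewrite (_ : (\int[_]_(_ in _) _)%E = 1%E) ?mule1//.
transitivity (\int[leb]_(t in `[u, (u + 1)%R]) 1%:E)%E; first by [].
transitivity (1%:E * leb `[u, (u + 1)%R])%E; first exact: integral_cst.
by rewrite mul1e lebesgue_measure_itv/= lte_fin ltrDl ltr01 -EFinB addrC addKr.
Qed.

(** At y = e^(-u) the bound is a multiple of y^n, which is just not integrable
    against dy / y^(n+1) at 0. *)
Lemma Mdil_test_fun_ge (x : Rn R n) (u : R) : unit_cube x -> 0 <= u ->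
  (((1 - expR (- n%:R)) * expR (- n%:R * u))%:E <=
    Mdil test_fun (x, Rexp (- u)))%E.
Proof.
move=> Qx u0; rewrite MdilE; have r0 : 0 < u + 1 by rewrite ltr_wpDl.
apply: le_trans (dil_max_test_fun_ge _ _ _ Qx u0); last 3 first.
- exact: exp_weight_ge0.
- exact: measurable_exp_weight.
- by move=> r rr0; rewrite invr_gt0 Vn_gt0.
under eq_integral do rewrite /exp_weight -mulNr.
rewrite integral_expR ?oppr_eq0 ?gt_eqF// ?ltrDl// -EFinM lee_fin (VnE n1 r0) -mulNr.
rewrite mulrDr mulr1 expRD.
set e := expR (- n%:R * u); set e1 := expR (- n%:R).
have e1_lt1 : e1 < 1 by rewrite -[ltRHS]expR0 ltr_expR oppr_lt0.
have e_le1 : e <= 1 by rewrite -[leRHS]expR0 ler_expR mulNr oppr_le0 mulr_ge0// ltW.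
have e_gt0 : 0 < e by exact: expR_gt0.
have e1_gt0 : 0 < e1 by exact: expR_gt0.
have ee : 0 < 1 - e * e1 by nra.
have -> : ((1 - e * e1) / n%:R)^-1 * ((e * e1 - e) / - n%:R) =
    (1 - e1) * e / (1 - e * e1).
  by field; rewrite !gt_eqF.
rewrite ler_pdivlMr//; nra.
Qed.

End counterexample.

(** * Failure of the remaining bounds *)

(** From e^x >= (1 + x / (k+1))^(k+1), which grows like x^(k+1). *)
Lemma expR_beats_monomial {R : realType} (K : R) (k : nat) :
  exists m : nat, K * (m.+3%:R) ^+ k < expR m%:R.
Proof.
pose c : R := k.+1%:R; have c0 : 0 < c by rewrite ltr0n.
have lower (x : R) : 0 <= x -> (x / c) ^+ k.+1 <= expR x.
  move=> x0; have -> : expR x = expR (x / c) ^+ k.+1.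
    by rewrite -expRM_natr divfK// gt_eqF.
  apply: lerXn2r; rewrite ?nnegrE ?expR_ge0 ?divr_ge0// ?ltW//.
  by rewrite (lt_le_trans _ (expR_ge1Dx _))// ltrDr.
(* If the inequality failed at x = m + 3, the lower bound for expR x would
   give x <= D. *)
pose D : R := K * expR 3 * c ^+ k.+1.
exists (Num.truncn `|D|); set m := Num.truncn _; pose x : R := m.+3%:R.
have x0 : 0 < x by rewrite ltr0n.
have Dx : D < x.
  apply: (le_lt_trans (ler_norm _)); apply: (lt_le_trans (truncnS_gt _)).
  by rewrite /x ler_nat -/m; exact: leq_trans (leqnSn _) (leqnSn _).
have -> : expR m%:R = expR x / expR 3 :> R.
  by rewrite -expRN -expRD /x -addn3 natrD addrK.
rewrite ltr_pdivlMr ?expR_gt0//; apply: lt_le_trans (lower x (ltW x0)).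
rewrite expr_div_n ltr_pdivlMr ?exprn_gt0// -/x [x ^+ k.+1]exprS.
have -> : K * x ^+ k * expR 3 * c ^+ k.+1 = D * x ^+ k by rewrite /D; ring.
by rewrite ltr_pM2r// exprn_gt0.
Qed.

Section unboundedness.
Context {R : realType} (n : nat) (n1 : (1 <= n)%N).
Notation leb := (@lebesgue_measure R).
Let f : Gn R n -> R := @test_fun R n.
Let mf : measurable_fun setT f. Proof. exact: measurable_test_fun. Qed.
Let n0 : 0 < n%:R :> R. Proof. by rewrite ltr0n. Qed.

Lemma measurable_MLeb_level (l : R) : measurable [set q | l%:E < MLeb f q]%E.
Proof.
rewrite -[X in measurable X]setTI; apply: emeasurable_fun_o_infty => //.
exact: measurable_MLeb.
Qed.

(** MLeb f is at least 1/(u+1) at height y = e^(-u), and the slab m <= u <= m + 1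
    already has Haar measure at least e^(nm): the average decays only like
    1 / |ln y| while the measure blows up like y^(-n). *)
Lemma haar_MLeb_level_ge (m : nat) :
  ((expR m%:R)%:E <= haar n [set q | (m.+3%:R^-1)%:E < MLeb f q])%E.
Proof.
pose I : set (Rpos R) := log_interval (- m.+1%:R) (- m%:R).
have mI : measurable I by exact: measurable_log_interval.
have mQ := @measurable_unit_cube R n.
apply: (@le_trans _ _ (haar n (@unit_cube R n `*` I))).
  rewrite haar_setX// lebesgue_unit_cube mul1e.
  have mm : - m.+1%:R < - m%:R :> R by rewrite ltrN2 ltr_nat.
  have /andP[+ _] := haar_Rpos_log_interval_bounds n1 mm.
  apply: le_trans; have -> : - m%:R - - m.+1%:R = 1 :> R by rewrite -natr1; ring.
  rewrite mul1r lee_fin ler_expR.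
  by rewrite mulrN opprK ler_peMl// ler1n.
apply: le_measure; rewrite ?inE.
- exact: measurableX.
- exact: measurable_MLeb_level.
move=> [x y] /= [Qx]; rewrite -(ln_RposK y) => /log_interval_Rexp.
set s := ln _ => /andP[ms sm].
have s0 : 0 <= - s by rewrite oppr_ge0 (le_trans sm)// oppr_le0.
apply: (@lt_le_trans _ _ ((- s + 1)^-1)%:E); last first.
  by have := MLeb_test_fun_ge Qx s0; rewrite opprK.
rewrite lte_fin ltf_pV2 ?posrE ?ltr0n//; last by rewrite ltr_wpDl.
by rewrite -natr1 ltrD2r (@le_lt_trans _ _ m.+1%:R)// ?ltr_nat// lerNl.
Qed.

Lemma MLeb_level_unbounded (p K : R) : 1 <= p ->
  exists2 l : R, 0 < l & (K%:E < (l `^ p)%:E * haar n [set q | l%:E < MLeb f q])%E.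
Proof.
move=> p1.
(* The heights are l = 1 / (m + 3) < 1, so l^p can be bounded below by an
   integer power. *)
pose k := (Num.truncn p).+1.
have pk : p <= k%:R by apply/ltW; exact: truncnS_gt.
have [m Km] := expR_beats_monomial K k.
exists m.+3%:R^-1; first by rewrite invr_gt0.
apply: (@lt_le_trans _ _ ((m.+3%:R^-1 `^ p)%:E * (expR m%:R)%:E)%E); last first.
  by apply: lee_wpmul2l (haar_MLeb_level_ge m); rewrite lee_fin powR_ge0.
apply: (@lt_le_trans _ _ (m.+3%:R ^- k * expR m%:R)%:E).
  by rewrite lte_fin mulrC ltr_pdivlMr// exprn_gt0.
rewrite -EFinM lee_fin ler_wpM2r ?expR_ge0//.
rewrite -exprVn -powR_mulrn ?invr_ge0//; apply: ger_powR => //.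
by rewrite invr_gt0 ltr0n invf_le1// ler1n.
Qed.

Lemma MLeb_not_weak_type11 : ~ weak_type11 (@MLeb R n).
Proof.
move=> [C HC]; have f1 := test_fun_Lfun n1 (lexx (1 : R)).
have N0 := Lnorm_ge0 (haar n) 1%E (EFin \o f).
have Noo := Lnorm_test_fun n1 (lexx (1 : R)).
have Nfin : ('N[haar n]_1[EFin \o f])%E \is a fin_num by rewrite ge0_fin_numE.
have [l l0] := MLeb_level_unbounded (C * fine ('N[haar n]_1[EFin \o f])%E) (lexx 1).
rewrite powRr1 ?(ltW l0)// ltNge => /negP; apply.
have := HC _ f1 _ l0; rewrite -[X in (_ <= _ * X)%E](fineK Nfin) => H.
apply: (@le_trans _ _ (l%:E * ((C / l)%:E * (fine ('N[haar n]_1[EFin \o f]))%:E))%E).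
  by apply: lee_wpmul2l H; rewrite lee_fin ltW.
by rewrite muleA -!EFinM mulrCA divff ?gt_eqF// mulr1.
Qed.

(** By Chebyshev's inequality an L^p bound would bound l^p times the measure of
    the level set {MLeb f > l}, uniformly in l. *)
Lemma MLeb_not_Lp_bounded (p : R) : 1 <= p -> ~ Lp_bounded p%:E (@MLeb R n).
Proof.
move=> p1 [C HC]; have fp := test_fun_Lfun n1 p1.
have p0 : 0 < p by exact: lt_le_trans p1.
have Noo := Lnorm_test_fun n1 p1.
have N0 := Lnorm_ge0 (haar n) p%:E (EFin \o f).
have Nfin : ('N[haar n]_p%:E[EFin \o f])%E \is a fin_num by rewrite ge0_fin_numE.
have := HC _ fp; set NM := ('N[_]_ _[MLeb _])%E => H.
have NM0 : (0 <= NM)%E by exact: Lnorm_ge0.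
have NMoo : (NM < +oo)%E.
  by apply: (le_lt_trans H); rewrite -(fineK Nfin) -EFinM ltry.
have NMfin : NM \is a fin_num by rewrite ge0_fin_numE.
have [l l0] := MLeb_level_unbounded (fine NM `^ p) p1.
rewrite ltNge => /negP; apply.
have mE := measurable_MLeb_level l.
rewrite -[X in (_ <= X)%E]poweR_EFin fineK// poweR_Lnorm ?gt_eqF//.
rewrite -[X in haar _ X]setIT -(integral_indic _ measurableT mE) -ge0_integralZl//; last 2 first.
- exact/measurable_EFinP.
- by rewrite lee_fin powR_ge0.
apply: ge0_le_integral => //.
- by move=> q _; rewrite mule_ge0 ?lee_fin ?powR_ge0.
- by apply: measurable_funeM; exact/measurable_EFinP.
- apply: (measurableT_comp (measurable_poweR _)); apply: measurableT_comp => //.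
  exact: measurable_MLeb.
move=> q _; rewrite gee0_abs ?MLeb_ge0// indicE; case: (boolP (q \in _)) => [|_]; last first.
  by rewrite mule0 poweR_ge0.
rewrite inE/= => lM; rewrite mule1 -poweR_EFin; apply: gt0_ler_poweR.
- exact: ltW.
- by rewrite in_itv/= leey andbT lee_fin ltW.
- by rewrite in_itv/= leey andbT MLeb_ge0.
- exact: ltW.
Qed.

(** On the cube times {s <= 0}, in the coordinate s = ln y, the integrand
    Mdil f * e^(-ns) is bounded below by the positive constant kappa. *)
Lemma Mdil_not_L1_bounded : ~ Lp_bounded 1%E (@Mdil R n).
Proof.
move=> [C HC]; have f1 := test_fun_Lfun n1 (lexx (1 : R)).
have N0 := Lnorm_ge0 (haar n) 1%E (EFin \o f).
have Noo := Lnorm_test_fun n1 (lexx (1 : R)).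
have Nfin : ('N[haar n]_1[EFin \o f])%E \is a fin_num by rewrite ge0_fin_numE.
have := HC _ f1; rewrite leNgt => /negP; apply.
rewrite -(fineK Nfin) -EFinM (_ : ('N[_]_ _[Mdil _])%E = +oo%E) ?ltry//.
rewrite Lnorm1; under eq_integral do rewrite gee0_abs ?Mdil_ge0//.
rewrite haar_integral; last 2 first.
- exact: measurable_Mdil.
- by move=> q; exact: Mdil_ge0.
apply/eqP; rewrite -leye_eq.
pose kappa : R := 1 - expR (- n%:R).
have kappa0 : 0 < kappa by rewrite subr_gt0 -[ltRHS]expR0 ltr_expR oppr_lt0.
have mMf := measurable_Mdil n1 mf.
pose G (q : Rn R n * measurableTypeR R) : \bar R :=
  (Mdil f (q.1, Rexp q.2) * (expR (- (n%:R * q.2)))%:E)%E.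
have G0 q : (0 <= G q)%E by rewrite mule_ge0 ?Mdil_ge0// lee_fin expR_ge0.
have mG : measurable_fun setT G.
  apply: emeasurable_funM.
    apply: measurableT_comp => //; apply/measurable_fun_pairP; split.
      exact: measurable_fst.
    exact: (measurableT_comp measurable_Rexp measurable_snd).
  by apply/measurable_EFinP; exact: (measurableT_comp (measurable_exp_weight n) measurable_snd).
have mQ := @measurable_unit_cube R n.
apply: (@le_trans _ _ (\int[lebesgue_Rn n]_(x in @unit_cube R n) +oo)%E).
  by rewrite integral_cst//= lebesgue_unit_cube mule1.
rewrite integral_mkcond; apply: ge0_le_integral => //.
- by move=> x _; apply: erestrict_ge0.
- by apply/(measurable_restrictT _ _).1.
- exact: (measurable_fun_fubini_tonelli_F G).
move=> x _; rewrite patchE; case: ifPn => [|_]; last first.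
  by apply: integral_ge0 => s _; exact: (G0 (x, s)).
rewrite inE => Qx.
have mI : measurable (`]-oo, 0]%classic : set (measurableTypeR R)) by exact: measurable_itv.
apply: (@le_trans _ _ (\int[leb]_(s in `]-oo, 0%R]) kappa%:E)%E).
  rewrite [leRHS](_ : _ = (kappa%:E * leb `]-oo, 0%R])%E); last exact: integral_cst.
  by rewrite lebesgue_measure_itv/= ltNyr add0e gt0_muley ?lte_fin.
have mGx : measurable_fun setT (fun s : measurableTypeR R => G (x, s)).
  exact: (measurableT_comp mG (measurable_pair1 x)).
apply: (@le_trans _ _ (\int[leb]_(s in `]-oo, 0%R]) G (x, s))%E); last first.
  by apply: ge0_subset_integral.
apply: ge0_le_integral => //.
- by move=> s _; rewrite lee_fin ltW.
- exact: measurable_funTS.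
move=> s /=; rewrite in_itv/= => s0.
have us : 0 <= - s by rewrite oppr_ge0.
have := Mdil_test_fun_ge n1 Qx us; rewrite opprK => h.
apply: (@le_trans _ _ ((kappa * expR (- n%:R * - s))%:E * (expR (- (n%:R * s)))%:E)%E).
  by rewrite -EFinM lee_fin -mulrA -expRD mulrNN subrr expR0 mulr1.
by apply: lee_wpmul2r; rewrite ?lee_fin ?expR_ge0.
Qed.
End unboundedness.

Unset Implicit Arguments.

Theorem theorem2 (R : realType) (n : nat) (n_ge1 : (1 <= n)%N) :
  [/\ (forall p : R, 1 <= p -> ~ Lp_bounded p%:E (@MLeb R n))
        /\ ~ weak_type11 (@MLeb R n),
      weak_type11 (@Mdil R n)
        /\ (forall p : \bar R, (1 < p)%E -> Lp_bounded p (@Mdil R n))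
    & ~ Lp_bounded 1%E (@Mdil R n)].
Proof.
split; first split.
- by move=> p; exact: MLeb_not_Lp_bounded.
- exact: MLeb_not_weak_type11.
- split; first exact: Mdil_weak_type11.
  move=> [p||//]; last by move=> _; exact: Mdil_Loo_bounded.
  by rewrite lte_fin; exact: Mdil_Lp_bounded.
- exact: Mdil_not_L1_bounded.
Qed.
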